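(* The system $(\overline{\triangle},\mu,S)$ is conservative, and the map $S:\overline{\triangle}\to\overline{\triangle}$ admits a unique, up to multiplicative constants, ergodic invariant measure $\mu$, absolutely continuous with respect to the Lebesgue measure $m$, given by the density $h(x,y)=\frac{1}{xy}$. The measure $\mu$ is $\sigma$-finite and $\mu(\overline{\triangle})=+\infty$.
   Context: $\overline{\triangle}=\{(x,y)\in\mathbb{R}^2: 1\ge x\ge y\ge 0\}$, and $m$ denotes the Lebesgue measure on $\overline{\triangle}$. Let $\Gamma_0=\{(x,y)\in\mathbb{R}^2: 1\ge x\ge y>1-x\}$ and $\Gamma_1=\overline{\triangle}\setminus\Gamma_0=\{(x,y)\in\mathbb{R}^2: 1-y\ge x\ge y\ge 0\}$. The map $S:\overline{\triangle}\to\overline{\triangle}$ is defined by $$S(x,y)=\begin{cases}\left(\frac{y}{x},\frac{1-x}{x}\right) & \text{if }(x,y)\in\Gamma_0,\\ \left(\frac{x}{1-y},\frac{y}{1-y}\right) & \text{if }(x,y)\in\Gamma_1.\end{cases}$$ The density $h$ of $\mu$ is taken with respect to $m$, that is, $d\mu=h\,dm$. *)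

(* Defs.v *)
From HB Require Import structures.
From mathcomp Require Import all_boot all_order all_algebra.
From mathcomp Require Import lra.
From mathcomp Require Import all_classical all_reals all_analysis.
From mathcomp Require Import measurable_realfun.

Set Implicit Arguments.
Unset Strict Implicit.
Unset Printing Implicit Defensive.

Import Order.TTheory GRing.Theory Num.Theory.
Import numFieldNormedType.Exports.

Local Open Scope classical_set_scope.
Local Open Scope ring_scope.

(* A dynamical system is given by a phase space X inside a measurable type T, *)
(* a map f sending X to itself (its values outside X are never used) and a    *)
(* measure on T. All notions below only involve subsets of X, so that         *)
(* X `&` f @^-1` A is the preimage of A under f : X -> X.                     *)

Definition invariant_measure d (T : measurableType d) (R : realType)
    (X : set T) (f : T -> T) (mu : set T -> \bar R) : Prop :=
  forall A, measurable A -> A `<=` X -> mu (X `&` f @^-1` A) = mu A.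

Definition ergodic d (T : measurableType d) (R : realType)
    (X : set T) (f : T -> T) (mu : set T -> \bar R) : Prop :=
  forall A, measurable A -> A `<=` X -> X `&` f @^-1` A = A ->
    mu A = 0%E \/ mu (X `\` A) = 0%E.

Definition wandering d (T : measurableType d)
    (X : set T) (f : T -> T) (W : set T) : Prop :=
  [/\ measurable W, W `<=` X
    & trivIset [set: nat] (fun n => X `&` iter n f @^-1` W)].

Definition conservative d (T : measurableType d) (R : realType)
    (X : set T) (f : T -> T) (mu : set T -> \bar R) : Prop :=
  forall W, wandering X f W -> mu W = 0%E.

(* The plane carries the sigma-algebra on which lebesgue_measure is declared.   *)
Notation plane R := (measurableTypeR R * measurableTypeR R)%type.

Definition triangle (R : realType) : set (plane R) :=
  [set z | 1 >= z.1 /\ z.1 >= z.2 /\ z.2 >= 0].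

Definition Gamma0 (R : realType) : set (plane R) :=
  [set z | 1 >= z.1 /\ z.1 >= z.2 /\ z.2 > 1 - z.1].

Definition Gamma1 (R : realType) : set (plane R) :=
  @triangle R `\` @Gamma0 R.

(* The last branch is only there for totality: it is not reached on the       *)
(* triangle.                                                                  *)
Definition triangle_map (R : realType) (z : plane R) : plane R :=
  if z \in @Gamma0 R then (z.2 / z.1, (1 - z.1) / z.1)
  else if z \in @Gamma1 R then (z.1 / (1 - z.2), z.2 / (1 - z.2))
  else z.

(* On the null set x * y = 0 the inverse takes its conventional value 0.      *)
Definition triangle_density (R : realType) (z : plane R) : R :=
  (z.1 * z.2)^-1.

Lemma Gamma1E (R : realType) :
  @Gamma1 R = [set z | 1 - z.2 >= z.1 /\ z.1 >= z.2 /\ z.2 >= 0].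
Proof.
apply/seteqP; split => -[x y]; rewrite /Gamma1 /triangle /Gamma0 /=.
  move=> [[x1 [yx y0]] nG]; split=> //.
  case: (lerP x (1 - y)) => // h; exfalso; apply: nG.
  by do !split=> //; lra.
move=> [h [yx y0]]; split; first by do !split=> //; lra.
by move=> [_ [_ h']]; lra.
Qed.

Lemma Gamma0_sub_triangle (R : realType) : @Gamma0 R `<=` @triangle R.
Proof. by move=> [x y] [/= x1 [yx h]]; do !split=> //=; lra. Qed.

Lemma triangle_map_Gamma0 (R : realType) (x y : R) : Gamma0 (x, y) ->
  triangle_map (x, y) = (y / x, (1 - x) / x).
Proof. by move=> G; rewrite /triangle_map mem_set. Qed.

Lemma triangle_map_Gamma1 (R : realType) (x y : R) : Gamma1 (x, y) ->
  triangle_map (x, y) = (x / (1 - y), y / (1 - y)).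
Proof.
by move=> G; rewrite /triangle_map memNset ?mem_set//; case: G.
Qed.

Lemma triangle_map_fun (R : realType) :
  set_fun (@triangle R) (@triangle R) (@triangle_map R).
Proof.
move=> [x y] T; have [G|G] := pselect (Gamma0 (x, y)).
  rewrite triangle_map_Gamma0//; move: G => [/= x1 [yx h]].
  have x0 : 0 < x by lra.
  rewrite /triangle /=; split; first by rewrite ler_pdivrMr// mul1r.
  by split; [rewrite ler_pM2r ?invr_gt0//; lra | apply: divr_ge0; lra].
have G1 : Gamma1 (x, y) by [].
rewrite triangle_map_Gamma1//; move: G1; rewrite Gamma1E => -[/= h [yx y0]].
have y1 : 0 < 1 - y by lra.
rewrite /triangle /=; split; first by rewrite ler_pdivrMr// mul1r.
by split; [rewrite ler_pM2r ?invr_gt0 | apply: divr_ge0; lra].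
Qed.

Lemma measurable_triangle (R : realType) : measurable (@triangle R).
Proof.
rewrite (_ : @triangle R = ([set: plane R] `&` [set z | z.1 <= cst 1 z]) `&`
  (([set: plane R] `&` [set z | z.2 <= z.1]) `&`
   ([set: plane R] `&` [set z | cst 0 z <= z.2]))); last by rewrite !setTI.
apply: measurableI; last apply: measurableI.
- exact: (@measurable_fun_le _ _ R setT fst (cst 1)).
- exact: (@measurable_fun_le _ _ R setT snd fst).
- exact: (@measurable_fun_le _ _ R setT (cst 0) snd).
Qed.

Lemma measurable_Gamma0 (R : realType) : measurable (@Gamma0 R).
Proof.
rewrite (_ : @Gamma0 R = ([set: plane R] `&` [set z | z.1 <= cst 1 z]) `&`
  (([set: plane R] `&` [set z | z.2 <= z.1]) `\`
   ([set: plane R] `&` [set z | z.2 <= 1 - z.1]))).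
  apply: measurableI; last apply: measurableD.
  - exact: (@measurable_fun_le _ _ R setT fst (cst 1)).
  - exact: (@measurable_fun_le _ _ R setT snd fst).
  - have m1 : measurable_fun [set: plane R] (fun z => 1 - z.1 : R).
      exact: measurable_funB.
    exact: (measurable_fun_le measurableT measurable_snd m1).
rewrite !setTI; apply/seteqP; split => z /=.
  move=> [? [? h]]; split=> //; split=> //=.
  by apply/negP; rewrite -ltNge.
by move=> [? [? /negP]]; rewrite -ltNge.
Qed.

Lemma measurable_Gamma1 (R : realType) : measurable (@Gamma1 R).
Proof. by apply: measurableD; [exact: measurable_triangle|exact: measurable_Gamma0]. Qed.

Lemma measurable_mem d (T : measurableType d) (A : set T) : measurable A ->
  measurable_fun [set: T] (fun z => z \in A).
Proof.
move=> mA; apply: (measurable_fun_bool true); rewrite setTI.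
rewrite (_ : _ @^-1` _ = A)//.
by apply/seteqP; split => z; [exact: set_mem|exact: mem_set].
Qed.

Lemma measurable_inv (R : realType) : measurable_fun [set: R] (@GRing.inv R).
Proof.
rewrite -(setvU [set 0 : R]); apply/measurable_funU.
- by apply: measurableC; exact: measurable_set1.
- exact: measurable_set1.
split; last exact: measurable_fun_set1.
apply: open_continuous_measurable_fun.
  by apply: closed_openC; exact: closed_eq.
by move=> x; rewrite inE /= => /eqP x0; exact: inv_continuous.
Qed.

Lemma measurable_triangle_map (R : realType) :
  measurable_fun [set: plane R] (@triangle_map R).
Proof.
have mdiv (f g : plane R -> R) : measurable_fun setT f -> measurable_fun setT g ->
    measurable_fun setT (fun z => f z / g z).
  move=> mf mg; apply: measurable_funM => //.
  exact: measurableT_comp (@measurable_inv R) mg.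
have m1B (f : plane R -> R) : measurable_fun setT f ->
    measurable_fun setT (fun z => 1 - f z).
  by move=> mf; exact: measurable_funB.
apply: measurable_fun_ifT.
- exact: measurable_mem (@measurable_Gamma0 R).
- by apply: measurable_fun_pair; apply: mdiv => //; exact: m1B.
- apply: measurable_fun_ifT => //.
  + exact: measurable_mem (@measurable_Gamma1 R).
  + by apply: measurable_fun_pair; apply: mdiv => //; exact: m1B.
Qed.

Lemma measurable_triangle_density (R : realType) :
  measurable_fun [set: plane R] (@triangle_density R).
Proof.
apply: (measurableT_comp (@measurable_inv R)).
exact: measurable_funM.
Qed.

Lemma triangle_density_ge0 (R : realType) (z : plane R) :
  triangle z -> 0 <= triangle_density z.
Proof.
by move=> [_ [yx y0]]; rewrite invr_ge0 mulr_ge0// (le_trans y0).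
Qed.

Definition lebesgue_triangle (R : realType) :
    {measure set (plane R) -> \bar R} :=
  mrestr (lebesgue_measure \x lebesgue_measure)%E (@measurable_triangle R).

Definition triangle_mu (R : realType) (A : set (plane R)) : \bar R :=
  (\int[lebesgue_triangle R]_(z in A `&` @triangle R) (triangle_density z)%:E)%E.

Section triangle_mu_measure.
Context (R : realType).

Let mu0 : triangle_mu (R := R) set0 = 0%E.
Proof. by rewrite /triangle_mu set0I integral_set0. Qed.

Let mu_ge0 A : (0 <= triangle_mu (R := R) A)%E.
Proof.
by apply: integral_ge0 => z [_ Tz]; rewrite lee_fin triangle_density_ge0.
Qed.

Let mu_sigma_additive : semi_sigma_additive (@triangle_mu R).
Proof.
move=> F mF tF mUF; rewrite /triangle_mu setI_bigcupl ge0_integral_bigcup//=.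
- by apply: is_cvg_ereal_nneg_natsum_cond => n _ _; exact: mu_ge0.
- by move=> k; apply: measurableI => //; exact: measurable_triangle.
- apply: measurable_funTS; apply/measurable_EFinP.
  exact: measurable_triangle_density.
- by move=> z [k _ [_ Tz]]; rewrite lee_fin triangle_density_ge0.
- exact: trivIset_setIr.
Qed.

HB.instance Definition _ := isMeasure.Build _ _ _ (@triangle_mu R)
  mu0 mu_ge0 mu_sigma_additive.

End triangle_mu_measure.

(* Main.v *)
(** The triangle map [S] is piecewise projective. In the coordinates
[1 - x, x - y, y] its two inverse branches are given by nonnegative unimodular
matrices, so the cylinder of a word of digits has Lebesgue measure
[1 / (2 A B C)], where [A <= B <= C] are the column sums of the product of the
matrices along the word, and the cylinders form a Markov chain for which
[(A, B, C)] goes to [(B, C, A + C)] with probability [A / (A + C)] and to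
[(A, B, A + C)] with probability [C / (A + C)]. From every state this chain
reaches [C <= 6 A] with probability at least 1/4, uniformly. There the distortion
is bounded, so an invariant set of positive measure fills a fixed proportion of
every cylinder; there two further digits [true] shrink the cylinder with
probability at least 1/56, so cylinders shrink to points almost everywhere. Both
facts together give ergodicity.

Conservativity comes from Maharam's criterion: [Gamma0] has finite measure and
almost every orbit visits it infinitely often. The same recurrence gives
uniqueness: for an invariant [nu] and a constant [c], the minimum of [nu] and
[c mu] can only decrease under [S], and it does not decrease at all because
[Gamma0] has finite measure; hence [{dnu / dmu > c}] is invariant modulo null
sets, so it is null or conull. *)
Require Import Defs.
From HB Require Import structures.
From mathcomp Require Import all_boot all_order all_algebra.
From mathcomp Require Import lra ring.
From mathcomp Require Import all_classical all_reals all_analysis.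
From mathcomp Require Import measurable_realfun.
Set Implicit Arguments.
Unset Strict Implicit.
Unset Printing Implicit Defensive.
Import Order.TTheory GRing.Theory Num.Theory.
Import numFieldNormedType.Exports.
Local Open Scope classical_set_scope.
Local Open Scope ring_scope.

(** * Integration *)

(** The obstacle is that long runs of [false] make cylinders arbitrarily skewed, so neither
    distortion nor contraction is uniform over words: both are controlled only at words with
    [C <= 6 A]. The probability 1/4 comes from two excursions, each a run of [false] closed by
    [true], and each favourable on at least half of the cylinder. Cylinder measures rest on one
    identity: the integral over a triangle of the inverse cube of a positive affine function is the
    area divided by the product of the values at the vertices. The inverse cube appears because both
    inverse branches are projective, of Jacobian [(1 + v) ^- 3]. Ergodicity depends on null sets
    only, and on the triangle [h] is positive off the base [y = 0], so the finite measure [m]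
    suffices. Density points are replaced by approximation of measurable sets, in measure, by unions
    of cylinders of one length. Recurrence is used through Borel-Cantelli: if the visits of a set to
    [Gamma0] have measures of bounded sum, while almost every point returns infinitely often, the
    set is null. This serves both conservativity and uniqueness. *)

Section density.
Local Open Scope ereal_scope.
Context d (T : measurableType d) (R : realType).
Variables (mu nu : {measure set T -> \bar R}) (f : T -> R).
Hypotheses (mf : measurable_fun setT f) (f0 : forall x, (0 <= f x)%R).
Hypothesis nuE : forall A, measurable A -> nu A = \int[mu]_(x in A) (f x)%:E.

Import HBNNSimple.

Lemma integral_density E (g : T -> \bar R) :
  measurable E -> measurable_fun E g -> (forall x, 0 <= g x) ->
  \int[nu]_(x in E) g x = \int[mu]_(x in E) (g x * (f x)%:E).
Proof.
move=> mE mg g0; pose h := nnsfun_approx mE mg.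
have mfE : measurable_fun E (EFin \o f) by apply/measurable_EFinP/measurable_funTS.
have -> : \int[nu]_(x in E) g x =
    lim (\int[nu]_(x in E) (EFin \o h n) x @[n --> \oo]).
  have gE x : E x -> g x = lim ((EFin \o h n) x @[n --> \oo]).
    by move=> Ex; apply/esym/cvg_lim => //; exact: cvg_nnsfun_approx.
  under eq_integral => x /[!inE] /gE -> //.
  apply: monotone_convergence => //.
  - by move=> n; apply/measurable_EFinP/measurable_funTS.
  - by move=> n x Ex //=; rewrite lee_fin.
  - by move=> x Ex a b ab; rewrite lee_fin; exact/lefP/nd_nnsfun_approx.
have -> : \int[mu]_(x in E) (g x * (f x)%:E) =
    lim (\int[mu]_(x in E) ((EFin \o h n) x * (f x)%:E) @[n --> \oo]).
  have gE x : E x -> g x * (f x)%:E = lim (((EFin \o h n) x * (f x)%:E) @[n --> \oo]).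
    by move=> Ex; apply/esym/cvg_lim => //; apply: cvgeZr => //; exact: cvg_nnsfun_approx.
  under eq_integral => x /[!inE] /gE -> //.
  apply: monotone_convergence => [//| | |].
  - by move=> n; apply/emeasurable_funM => //; apply/measurable_EFinP/measurable_funTS.
  - by move=> n x Ex /=; rewrite mule_ge0 ?lee_fin.
  - by move=> x Ex a b ab/=; rewrite lee_wpmul2r ?lee_fin//; exact/lefP/nd_nnsfun_approx.
congr (lim (_ @ \oo)); apply/funext => n.
transitivity (\sum_(r \in range (h n))
    \int[nu]_(x in E) (r * \1_(h n @^-1` [set r]) x)%:E).
  under eq_integral do rewrite /= fimfunE -fsumEFin//.
  rewrite ge0_integral_fsum//; last 2 first.
  - by move=> y; apply/measurable_EFinP; exact: measurable_funM.
  - by move=> y x _; rewrite nnfun_muleindic_ge0.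
transitivity (\sum_(r \in range (h n))
    \int[mu]_(x in E) ((r * \1_(h n @^-1` [set r]) x)%:E * (f x)%:E)); last first.
  rewrite -ge0_integral_fsum//.
  - apply: eq_integral => x _; rewrite -ge0_mule_fsuml; last first.
      by move=> r; exact: nnfun_muleindic_ge0.
    by rewrite /= fsumEFin// -fimfunE.
  - move=> y; apply: emeasurable_funM => //.
    by apply/measurable_EFinP; exact: measurable_funM.
  - by move=> y x _; apply: mule_ge0; [exact: nnfun_muleindic_ge0|rewrite lee_fin].
apply: eq_fsbigr => r _; rewrite integralZl_indic_nnsfun//.
have [r0|r0] := ltP r 0%R.
  rewrite preimage_nnfun0// indic0 !integral0_eq ?mule0// => x _.
  by rewrite mulr0 mul0e.
under [RHS]eq_integral do rewrite EFinM -muleA.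
rewrite ge0_integralZl//.
- rewrite integral_indic// nuE; last exact: measurableI.
  congr (_ * _).
  by rewrite setIC integral_mkcondr; apply: eq_integral => x _; rewrite epatch_indic muleC.
- by apply: emeasurable_funM => //; exact/measurable_EFinP.
- by move=> x _; rewrite mule_ge0 ?lee_fin.
Qed.

End density.

(** Two-sided derivatives are asked at the endpoints too, so that continuity there comes for free,
    and the degenerate case [a = b] is allowed. *)
Lemma continuous_FTC2_is_derive (R : realType) (a b : R) (f F : R -> R) :
  a <= b ->
  (forall x, x \in `[a, b] -> is_derive x 1 F (f x)) ->
  (forall x, x \in `[a, b] -> derivable f x 1) ->
  (\int[lebesgue_measure]_(x in `[a, b]) (f x)%:E = (F b - F a)%:E)%E.
Proof.
rewrite le_eqVlt => /predU1P[<- _ _|ab dF df].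
  by rewrite set_itv1 integral_set1 subrr.
have cF x : x \in `[a, b] -> {for x, continuous F}.
  by move=> /dF h; apply/differentiable_continuous/derivable1_diffP; case: h.
have cf x : x \in `[a, b] -> {for x, continuous f}.
  by move=> /df h; exact/differentiable_continuous/derivable1_diffP.
rewrite (@continuous_FTC2 _ f F)//.
- apply/subspace_continuousP => x /= xab.
  by apply: cvg_within_filter; apply: cf.
- split.
  + by move=> x xab; case: (dF x (subset_itv_oo_cc xab)).
  + by apply: cvg_at_right_filter; apply: cF; rewrite in_itv/= lexx ltW.
  + by apply: cvg_at_left_filter; apply: cF; rewrite in_itv/= lexx ltW.
- move=> x xab; rewrite derive1E.
  by case: (dF x (subset_itv_oo_cc xab)).
Qed.

Definition mdensity d (T : measurableType d) (R : realType)
    (mu : {measure set T -> \bar R}) (f : T -> R)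
    of measurable_fun setT f & (forall x, 0 <= f x) :=
  fun A => (\int[mu]_(x in A) (f x)%:E)%E.

Section mdensity_measure.
Local Open Scope ereal_scope.
Context d (T : measurableType d) (R : realType).
Variables (mu : {measure set T -> \bar R}) (f : T -> R).
Hypotheses (mf : measurable_fun setT f) (f0 : forall x, (0 <= f x)%R).
Local Notation m := (mdensity mu mf f0).

Let m0 : m set0 = 0.
Proof. exact: integral_set0. Qed.

Let m_ge0 A : 0 <= m A.
Proof. by apply: integral_ge0 => x _; rewrite lee_fin. Qed.

Let m_sigma_additive : semi_sigma_additive m.
Proof.
by apply: semi_sigma_additive_nng_induced;
  [exact/measurable_EFinP|move=> x; rewrite lee_fin].
Qed.

HB.instance Definition _ := isMeasure.Build _ _ _ m m0 m_ge0 m_sigma_additive.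

End mdensity_measure.

(** * One-variable substitutions *)

Section substitution.
Context (R : realType).
Local Notation L := (@lebesgue_measure R).
Local Notation MR := (measurableTypeR R).
Local Open Scope ereal_scope.

(** Rays [[c, +oo[] form a pi-system generating the Borel sets, and both the image under [phi] of
    [f dx] on [D] and Lebesgue measure on [D'] are finite on them; agreement on rays is thus
    agreement of measures. A substitution is reduced to one primitive. *)
Lemma integral_substitution (phi f : MR -> R) (D D' : set MR) (g : MR -> \bar R) :
  measurable D -> measurable D' ->
  @measurable_fun _ _ MR MR setT phi -> measurable_fun setT f -> (forall x, (0 <= f x)%R) ->
  L D' < +oo ->
  (forall c, \int[L]_(x in D `&` phi @^-1` `[c, +oo[) (f x)%:E = L (D' `&` `[c, +oo[)) ->
  measurable_fun setT g -> (forall x, 0 <= g x) ->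
  \int[L]_(x in D) (g (phi x) * (f x)%:E) = \int[L]_(x in D') g x.
Proof.
move=> mD mD' mphi mf f0 D'oo H mg g0.
pose F x := (f x * \1_D x)%R.
have mF : measurable_fun setT F by exact: measurable_funM.
have F0 x : (0 <= F x)%R by rewrite mulr_ge0.
pose I x : R := \1_D' x.
have mI : measurable_fun setT I by exact: measurable_indic.
have I0 x : (0 <= I x)%R by [].
pose m1' : {measure set MR -> \bar R} := @pushforward _ _ MR MR R (mdensity L mF F0) phi.
pose m1 := m1' mphi.
pose m2 : {measure set MR -> \bar R} := mdensity L mI I0.
have FE (h : MR -> \bar R) A : measurable A ->
    \int[L]_(x in A) (h x * (F x)%:E) = \int[L]_(x in D `&` A) (h x * (f x)%:E).
  move=> mA; rewrite setIC integral_mkcondr; apply: eq_integral => x _.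
  by rewrite epatch_indic /= /F EFinM muleA.
have IE (h : MR -> \bar R) A : measurable A ->
    \int[L]_(x in A) (h x * (I x)%:E) = \int[L]_(x in D' `&` A) h x.
  move=> mA; rewrite setIC integral_mkcondr; apply: eq_integral => x _.
  by rewrite epatch_indic.
have m1E A : measurable A -> m1 A = \int[L]_(x in D `&` phi @^-1` A) (f x)%:E.
  move=> mA; rewrite /m1 /m1' /= /pushforward /mdensity.
  under eq_integral do rewrite -[(F _)%:E]mul1e.
  rewrite (FE (cst 1)); last by rewrite -[X in measurable X]setTI; exact: (mphi measurableT A mA).
  by under eq_integral do rewrite mul1e.
have m2E A : measurable A -> m2 A = L (D' `&` A).
  move=> mA; rewrite /m2 /= /mdensity.
  under eq_integral do rewrite -[(I _)%:E]mul1e.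
  by rewrite (IE (cst 1))// integral_cst ?mul1e//; exact: measurableI.
have m12 A : measurable A -> m1 A = m2 A.
  move=> mA.
  apply: (@measure_unique _ R MR (@RGenCInfty.G R) (fun n => `[(- n%:R)%R, +oo[%classic) _ _ _ _ m1 m2) => //.
  - exact: RGenCInfty.measurableE.
  - move=> _ _ [x ->] [y ->]; exists (Num.max x y).
    apply/seteqP; split => z /=; rewrite !in_itv /= !andbT ge_max.
      by move=> [-> ->].
    by move/andP.
  - by move=> i; exists (- i%:R)%R.
  - apply/seteqP; split => // x _; have [n xn] := ltr_add_invr (ltr01 : (0 < 1 :> R)%R).
    exists (Num.truncn `|x|).+1 => //=; rewrite in_itv/= andbT lerNl.
    by rewrite (le_trans (ler_norm _))// normrN ltW// truncnS_gt.
  - by move=> _ [x ->]; rewrite m1E// m2E// H.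
  - move=> n; rewrite m1E// H; apply: le_lt_trans D'oo.
    by apply: le_measure; rewrite ?inE//; exact: measurableI.
transitivity (\int[m2]_x g x); last first.
  rewrite (@integral_density _ _ _ L m2 I)//.
  by rewrite IE// setIT.
transitivity (\int[m1]_x g x); last first.
  by apply: eq_measure_integral => A mA _; exact: m12.
rewrite (ge0_integral_pushforward mphi)//=.
rewrite preimage_setT (@integral_density _ _ _ L (mdensity L mF F0) F)//; last first.
  exact: (measurableT_comp mg mphi).
by rewrite (FE (g \o phi)) ?setIT.
Qed.

Lemma ge0_integral_mull (c : R) (g : MR -> \bar R) : (0 < c)%R ->
  measurable_fun setT g -> (forall x, 0 <= g x) ->
  c%:E * \int[L]_x g (c * x)%R = \int[L]_x g x.
Proof.
move=> c0 mg g0.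
have mc : @measurable_fun _ _ MR MR setT (fun x : MR => c * x : MR)%R.
  exact: measurable_funM.
pose p' : {measure set MR -> \bar R} := @pushforward _ _ MR MR R L (fun x : MR => c * x : MR)%R.
pose p := p' mc.
pose m : {measure set MR -> \bar R} := mscale (NngNum (ltW c0)) p.
transitivity (\int[m]_x g x); last first.
  apply: eq_measure_integral => A mA _; apply/esym/lebesgue_measure_unique => //.
  move=> _ [[a b]] _ <-; rewrite /m /= /mscale /= /p /p' /= /pushforward.
  rewrite (_ : _ @^-1` _ = `](a / c)%R, (b / c)%R]%classic); last first.
    apply/seteqP; split => x /=; rewrite !in_itv/= ltr_pdivrMr// ler_pdivlMr//;
    by rewrite (mulrC x).
  rewrite !lebesgue_measure_itv/= !lte_fin ltr_pM2r ?invr_gt0//.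
  case: ifPn => _; last by rewrite mule0.
  by rewrite -!EFinB -EFinM; congr (_%:E); field; rewrite gt_eqF.
rewrite ge0_integral_mscale//= (ge0_integral_pushforward mc)//.
Qed.

Lemma ge0_integral_onem (g : MR -> \bar R) :
  measurable_fun setT g -> (forall x, 0 <= g x) ->
  \int[L]_x g (1 - x)%R = \int[L]_x g x.
Proof.
move=> mg g0.
have mc : @measurable_fun _ _ MR MR setT (fun x : MR => 1 - x : MR)%R.
  exact: measurable_funB.
pose p' : {measure set MR -> \bar R} := @pushforward _ _ MR MR R L (fun x : MR => 1 - x : MR)%R.
pose m := p' mc.
transitivity (\int[m]_x g x); last first.
  apply: eq_measure_integral => A mA _; apply/esym/lebesgue_measure_unique => //.
  move=> _ [[a b]] _ <-; rewrite /m /p' /= /pushforward.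
  rewrite (_ : _ @^-1` _ = `[(1 - b)%R, (1 - a)%R[%classic); last first.
    by apply/seteqP; split => x /=; rewrite !in_itv/= => /andP[? ?]; apply/andP; split; lra.
  rewrite !lebesgue_measure_itv/= !lte_fin ltrD2l ltrN2.
  case: ifPn => _ //.
  by rewrite -!EFinB; congr (_%:E); ring.
by rewrite (ge0_integral_pushforward mc).
Qed.

Lemma ge0_integral_inv1D (g : MR -> \bar R) :
  measurable_fun setT g -> (forall x, 0 <= g x) ->
  \int[L]_(v in `[0%R, 1%R]) (g (1 + v)^-1%R * ((1 + v) ^- 2)%R%:E) =
  \int[L]_(t in `[2^-1%R, 1%R]) g t.
Proof.
move=> mg g0.
have m1D : measurable_fun [set: MR] (fun v : MR => 1 + v : R)%R.
  exact: measurable_funD.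
apply: integral_substitution => //.
- exact: measurableT_comp (@measurable_inv R) m1D.
- apply: (measurableT_comp (@measurable_inv R)); exact: measurable_funX.
- by move=> x; rewrite invr_ge0 sqr_ge0.
- by rewrite lebesgue_measure_itv/=; case: ifP => _ //; rewrite -EFinB ltry.
- move=> c.
  have FTC q : (0 <= q)%R -> \int[L]_(v in `[0%R, q]) ((1 + v) ^- 2)%:E = (1 - (1 + q)^-1)%:E.
    move=> q0; apply: etrans.
      apply: (@continuous_FTC2_is_derive _ _ _ _ (fun v => - (1 + v)^-1)%R) => //.
    + move=> x; rewrite in_itv/= => /andP[x0 xq].
      have x1 : (1 + x != 0)%R by rewrite gt_eqF//; lra.
      by apply: is_derive_eq; rewrite /GRing.scale/=; field.
    + move=> x; rewrite in_itv/= => /andP[x0 xq].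
      have x1 : ((1 + x) ^+ 2 != 0)%R by rewrite expf_neq0// gt_eqF//; lra.
      exact: ex_derive.
    + by rewrite /= addr0 invr1; congr (_%:E); ring.
  have phiE v : (0 <= v)%R -> (c <= (1 + v)^-1)%R = (c * (1 + v) <= 1)%R.
    by move=> v0; rewrite -[in LHS](mul1r (_^-1)%R) ler_pdivlMr//; lra.
  (* The ray misses, contains or cuts [[1/2, 1]], and its preimage in [[0, 1]] is empty, everything
     or [[0, 1/c - 1]]. *)
  have [c1|c1] := ltP 1%R c.
    rewrite (_ : _ `&` _ = set0); last first.
      apply/seteqP; split => v //=; rewrite !in_itv/= andbT => -[/andP[v0 v1]].
      by rewrite phiE// => ?; nra.
    rewrite (_ : _ `&` _ = set0) ?integral_set0 ?measure0//.
    by apply/seteqP; split => v //=; rewrite !in_itv/= andbT => -[/andP[v0 v1]]; lra.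
  have [c2|c2] := leP c 2^-1%R.
    rewrite (_ : _ `&` _ = `[0%R, 1%R]%classic); last first.
      apply/seteqP; split => v /=; rewrite !in_itv/= andbT; first by case.
      move=> /andP[v0 v1].
      by rewrite phiE// v0 v1; split => //; nra.
    rewrite (_ : _ `&` _ = `[2^-1%R, 1%R]%classic); last first.
      apply/seteqP; split => v /=; rewrite !in_itv/= andbT; first by case.
      move=> /andP[v0 v1].
      by rewrite v0 v1; split => //; lra.
    rewrite FTC// lebesgue_measure_itv/= lte_fin ifT; last by lra.
    by rewrite -EFinB; congr (_%:E); lra.
  have c0 : (0 < c)%R by lra.
  have ci : (c * c^-1 = 1)%R by rewrite divff// gt_eqF.
  rewrite (_ : _ `&` _ = `[0%R, (c^-1 - 1)%R]%classic); last first.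
    apply/seteqP; split => v /=; rewrite !in_itv/= andbT.
      by move=> [/andP[v0 v1]]; rewrite phiE// v0/= => ?; nra.
    move=> /andP[v0 v1]; rewrite phiE// v0/=; split; nra.
  rewrite (_ : _ `&` _ = `[c, 1%R]%classic); last first.
    apply/seteqP; split => v /=; rewrite !in_itv/= andbT.
      by move=> [/andP[v0 ->] ->].
    by move=> /andP[v0 ->]; rewrite v0; split=> //; lra.
  rewrite FTC; last by nra.
  rewrite (_ : 1 + (c^-1 - 1) = c^-1)%R; last by lra.
  rewrite invrK lebesgue_measure_itv/= lte_fin.
  move: c1; rewrite le_eqVlt => /predU1P[->|->]; last by rewrite -EFinB.
  by rewrite ltxx subrr.
Qed.

End substitution.

(** * Change of variables for the triangle map *)

Definition Gamma (R : realType) (b : bool) : set (plane R) :=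
  if b then @Gamma0 R else @Gamma1 R.

(** The inverse of [S] on [Gamma b], extended by the same formula; both branches have Jacobian
    [(1 + z.2) ^- 3]. *)
Definition branch (R : realType) (b : bool) (z : plane R) : plane R :=
  if b then ((1 + z.2)^-1, z.1 / (1 + z.2))
  else (z.1 / (1 + z.2), z.2 / (1 + z.2)).

Section change_of_variables.
Context (R : realType).
Local Notation L := (@lebesgue_measure R).
Local Notation MR := (measurableTypeR R).
Local Notation L2 := (L \x L)%E.
Local Notation S := (@triangle_map R).

Lemma measurable_Gamma b : measurable (@Gamma R b).
Proof. by case: b; [exact: measurable_Gamma0|exact: measurable_Gamma1]. Qed.

Lemma Gamma_sub_triangle b : @Gamma R b `<=` @triangle R.
Proof. by case: b; [exact: Gamma0_sub_triangle|exact: subDsetl]. Qed.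

Lemma measurable_branch b : measurable_fun [set: plane R] (@branch R b).
Proof.
have m1D : measurable_fun [set: plane R] (fun z => 1 + z.2 : R).
  exact: measurable_funD.
have mi := measurableT_comp (@measurable_inv R) m1D.
by case: b; apply: measurable_fun_pair => //; exact: measurable_funM.
Qed.

Lemma preimage_measurable (E : set (plane R)) :
  measurable E -> measurable (S @^-1` E).
Proof.
by move=> mE; rewrite -[X in measurable X]setTI; exact: measurable_triangle_map.
Qed.

(** The inequality [y > 1 - x] in [Gamma0] is strict, so [S] maps [Gamma0] onto the triangle without
    its diagonal. This is the set that the change of variables has to ignore. *)
Lemma diagonal_null : (L2 [set z : plane R | z.1 = z.2] = 0)%E.
Proof.
rewrite /product_measure1 integral0_eq// => x _ /=.
rewrite (_ : xsection _ _ = [set x]) ?lebesgue_measure_set1//.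
by apply/seteqP; split => y /=; rewrite /xsection /= inE.
Qed.

Local Open Scope ereal_scope.

(** With [t = 1 / (1 + v)], [dt] contributes [(1 + v) ^- 2]; the factor [t], which comes from
    rescaling the inner variable, supplies the third power. *)
Lemma integral_section_substitution (G : MR -> \bar R) :
  measurable_fun setT G -> (forall x, 0 <= G x) ->
  \int[L]_(t in `[2^-1%R, 1%R]) (t%:E * G ((1 - t) / t)%R) =
  \int[L]_(v in `[0%R, 1%R]) (((1 + v) ^- 3)%:E * G v).
Proof.
move=> mG G0.
pose g (t : MR) := `|t|%:E * G ((1 - t) / t)%R.
have mi : @measurable_fun _ _ MR MR setT (fun t : MR => (1 - t) / t : MR)%R.
  apply: measurable_funM; last exact: measurable_inv.
  exact: measurable_funB.
have mg : measurable_fun setT g.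
  apply: emeasurable_funM; last exact: (measurableT_comp mG mi).
  by apply/measurable_EFinP; exact: (@normr_measurable R setT).
have g0 t : 0 <= g t by rewrite mule_ge0 ?lee_fin.
rewrite [LHS](_ : _ = \int[L]_(t in `[2^-1%R, 1%R]) g t); last first.
  apply: eq_integral => t; rewrite inE/= in_itv/= => /andP[t0 _].
  by rewrite /g ger0_norm//; lra.
rewrite -ge0_integral_inv1D//; apply: eq_integral => v; rewrite inE/= in_itv/=.
move=> /andP[v0 _]; have v1 : (0 < 1 + v)%R by lra.
rewrite /g ger0_norm ?invr_ge0 ?ltW//.
rewrite (_ : (1 - _) / _ = v)%R; last by field; rewrite gt_eqF.
rewrite muleAC -EFinM; congr (_%:E * _).
by field; rewrite gt_eqF.
Qed.

(** Take as coordinates the denominator [t] (that is [x] on [Gamma0], [1 - y] on [Gamma1]) and the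
    remaining variable [u]: [S] sends the point to [(u / t, (1 - t) / t)]. It dilates each fibre and
    moves fibres according to [t] alone, so Tonelli and two one-variable substitutions suffice. *)
Lemma triangle_map_change_of_variables b (E : set (plane R)) (k : plane R -> \bar R) :
  measurable E -> E `<=` @triangle R ->
  measurable_fun setT k -> (forall z, 0 <= k z) ->
  \int[L2]_(z in Gamma b `&` S @^-1` E) k z =
  \int[L2]_(w in E) (k (branch b w) * ((1 + w.2) ^- 3)%:E).
Proof.
move=> mE ET mk k0.
pose E' := if b then E `\` [set z : plane R | z.1 = z.2] else E.
have mdiag : measurable [set z : plane R | z.1 = z.2].
  rewrite (_ : [set z | _] = ([set: plane R] `&` [set z | z.1 <= z.2]%R) `&`
      ([set: plane R] `&` [set z | z.2 <= z.1]%R)); last first.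
    rewrite !setTI; apply/seteqP; split => z /=; first by move=> ->.
    by move=> [h1 h2]; apply/eqP; rewrite eq_le h1.
  apply: measurableI.
  - exact: (@measurable_fun_le _ _ R setT fst snd).
  - exact: (@measurable_fun_le _ _ R setT snd fst).
have mE' : measurable E' by rewrite /E'; case: (b) => //; exact: measurableD.
have E'E : E' `<=` E by rewrite /E'; case: (b) => // z [].
pose Q (w : plane R) := k (branch b w) * (\1_E' w)%:E.
have mQ : measurable_fun setT Q.
  apply: emeasurable_funM; first exact: (measurableT_comp mk (@measurable_branch b)).
  by apply/measurable_EFinP; exact: measurable_indic.
have Q0 w : 0 <= Q w by rewrite mule_ge0// lee_fin.
pose G (v : MR) := \int[L]_u Q (u, v).
have mG : measurable_fun setT G by exact: measurable_fun_fubini_tonelli_G.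
have G0 v : 0 <= G v by exact: integral_ge0.
have Qout u v : ~ (0 <= v <= 1)%R -> Q (u, v) = 0.
  move=> v01; rewrite /Q indicE memNset ?mule0//.
  by move=> /E'E/ET[/= u1 [vu v0]]; apply: v01; rewrite v0/= (le_trans vu).
have m1D : measurable_fun [set: MR] (fun v : MR => 1 + v : R)%R.
  exact: measurable_funD.
have mc : measurable_fun [set: MR] (fun v : MR => `|(1 + v) ^- 3|%:E).
  apply/measurable_EFinP; apply: measurableT_comp => //.
  apply: (measurableT_comp (@measurable_inv R)); exact: measurable_funX.
have mc2 : measurable_fun [set: plane R] (fun w => `|(1 + w.2) ^- 3|%:E).
  exact: (measurableT_comp mc measurable_snd).
transitivity (\int[L]_(t in `[2^-1%R, 1%R]) (t%:E * G ((1 - t) / t)%R)); last first.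
  rewrite integral_section_substitution//.
  pose F w := k (branch b w) * `|(1 + w.2) ^- 3|%:E.
  have mF : measurable_fun setT F.
    by apply: emeasurable_funM => //; exact: (measurableT_comp mk (@measurable_branch b)).
  have F0 w : 0 <= F w by rewrite mule_ge0// lee_fin.
  transitivity (\int[L2]_(w in E) F w); last first.
    apply: eq_integral => -[u v]; rewrite inE => /ET[/= u1 [vu v0]].
    by rewrite /F /= ger0_norm// invr_ge0 exprn_ge0//; lra.
  transitivity (\int[L2]_(w in E') F w); last first.
    rewrite /E'; case: (b) => //.
    rewrite [RHS](@ge0_negligible_integral _ _ _ _ E [set z : plane R | z.1 = z.2])//.
    - exact: measurable_funTS.
    - exact: diagonal_null.
  rewrite [RHS]integral_mkcond.
  transitivity (\int[L2]_w (Q w * `|(1 + w.2) ^- 3|%:E)); last first.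
    by apply: eq_integral => w _; rewrite epatch_indic /= /F /Q muleAC.
  rewrite fubini_tonelli2//; last 2 first.
  - exact: emeasurable_funM.
  - by move=> w; rewrite mule_ge0// lee_fin.
  rewrite integral_mkcond; apply: eq_integral => v _; rewrite /fubini_G /=.
  rewrite ge0_integralZr//; last exact: (measurableT_comp mQ (measurable_pair2 v)).
  rewrite patchE muleC -/(G v); case: ifPn => v01.
    rewrite ger0_norm//; move: v01; rewrite inE/= in_itv/= => /andP[v0 _].
    by rewrite invr_ge0 exprn_ge0//; lra.
  rewrite [G v]integral0_eq ?mul0e// => u _; apply: Qout.
  by move: v01; rewrite notin_setE/= in_itv.
have mA : measurable (Gamma b `&` S @^-1` E).
  by apply: measurableI; [exact: measurable_Gamma|exact: preimage_measurable].
pose K z := k z * (\1_(Gamma b `&` S @^-1` E) z)%:E.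
have mK : measurable_fun setT K.
  apply: emeasurable_funM => //.
  by apply/measurable_EFinP; exact: measurable_indic.
have K0 z : 0 <= K z by rewrite mule_ge0// lee_fin.
pose P (t u : R) : plane R := if b then (t, u) else (u, 1 - t)%R.
transitivity (\int[L]_t \int[L]_u K (P t u)).
  rewrite integral_mkcond; transitivity (\int[L2]_z K z).
    by apply: eq_integral => z _; rewrite epatch_indic.
  rewrite /P; case: (b); first by rewrite fubini_tonelli1.
  (* On [Gamma1] the outer variable is [y], and a reflection replaces it by [t = 1 - y]. *)
  transitivity (\int[L]_y fubini_G L K y).
    exact: (@fubini_tonelli2 _ _ MR MR R L L K mK K0).
  symmetry.
  apply: (@ge0_integral_onem R (fubini_G L K)).
    exact: (@measurable_fun_fubini_tonelli_G _ _ MR MR R L K mK K0).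
  by move=> y; exact: integral_ge0.
have SP t u : Gamma b (P t u) -> S (P t u) = (t^-1 * u, (1 - t) / t)%R.
  rewrite /Gamma /P; case: (b) => G'.
    by rewrite triangle_map_Gamma0// mulrC.
  rewrite triangle_map_Gamma1//; congr pair; last by congr (_ / _)%R; lra.
  by rewrite mulrC; congr (_^-1 * _)%R; lra.
have KP t u : K (P t u) = if t \in `[2^-1, 1]%R then Q (t^-1 * u, (1 - t) / t)%R else 0.
  (* [x >= y > 1 - x] gives [x > 1/2], and [y <= x <= 1 - y] gives [1 - y >= 1/2]. *)
  have GP : Gamma b (P t u) -> t \in `[2^-1, 1]%R.
    rewrite in_itv/= /Gamma /P; case: (b).
      by move=> [/= t1 [ut tu]]; apply/andP; split; lra.
    by rewrite Gamma1E => -[/= ut [tu t1]]; apply/andP; split; lra.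
  case: ifPn => [t01|/negP tN]; last first.
    by rewrite /K indicE memNset ?mule0// => -[/GP].
  have t0 : (0 < t)%R by move: t01; rewrite in_itv/= => /andP[? _]; lra.
  have t1 : (t <= 1)%R by move: t01; rewrite in_itv/= => /andP[].
  have v1 : (1 + (1 - t) / t = t^-1)%R by field; rewrite gt_eqF.
  have branchE : branch b (t^-1 * u, (1 - t) / t)%R = P t u.
    rewrite /branch /P; case: (b); rewrite /= v1 ?invrK; congr pair => //;
      by field; rewrite gt_eqF.
  rewrite /K /Q branchE; congr (k _ * _%:E); rewrite !indicE; congr ((nat_of_bool _)%:R).
  have u1 : (t^-1 * u <= 1)%R = (u <= t)%R by rewrite mulrC ler_pdivrMr// mul1r.
  have u2 : ((1 - t) / t <= t^-1 * u)%R = (1 - t <= u)%R.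
    by rewrite [(t^-1 * u)%R]mulrC ler_pM2r// invr_gt0.
  apply/idP/idP; rewrite !inE.
    move=> [Gz] /=; rewrite SP// => Ew; rewrite /E'; move: Gz; rewrite /Gamma /P.
    case: (b) => // -[/= _ [_ tu]]; split => //= tE.
    have uE : u = (1 - t)%R.
      by apply: (@mulfI _ t^-1%R); rewrite ?invr_neq0 ?gt_eqF// tE mulrC.
    by move: tu; rewrite uE ltxx.
  move=> E'w; have Ew := E'E _ E'w; have [/= h1 [h2 h3]] := ET _ Ew.
  have Gz : Gamma b (P t u).
    move: E'w; rewrite u1 in h1; rewrite u2 in h2.
    rewrite /E' /Gamma /P; case: (b).
      move=> [_ /= /eqP h]; split => //; split => //=.
      rewrite lt_neqAle h2 andbT; apply: contra h => /eqP <-.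
      by rewrite mulrC.
    by move=> _; rewrite Gamma1E /=; split; [lra|split; [done|lra]].
  by split => //=; rewrite SP.
rewrite [RHS]integral_mkcond; apply: eq_integral => t _; rewrite patchE.
rewrite mem_setE.
case: ifPn => t01; last by apply: integral0_eq => u _; rewrite KP (negbTE t01).
under eq_integral do rewrite KP t01.
have t0 : (0 < t)%R by move: t01; rewrite in_itv/= => /andP[? _]; lra.
rewrite /G -[in RHS](@ge0_integral_mull _ t^-1%R) ?invr_gt0//; last first.
  exact: (measurableT_comp mQ (measurable_pair2 _)).
by rewrite muleA -EFinM divff ?mul1e// gt_eqF.
Qed.
End change_of_variables.

(** * The invariant measure *)

Section triangle_measures.
Context (R : realType).
Local Notation L := (@lebesgue_measure R).
Local Notation MR := (measurableTypeR R).
Local Notation L2 := (L \x L)%E.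
Local Notation S := (@triangle_map R).
Local Notation T := (@triangle R).
Local Notation mu := (@triangle_mu R).
Local Open Scope ereal_scope.

Lemma triangle_muE (A : set (plane R)) : measurable A ->
  mu A = \int[L2]_(z in A `&` T) (triangle_density z)%:E.
Proof.
move=> mA; apply: eq_measure_integral => B mB BAT.
by rewrite /= /mrestr setIidl// => z /BAT[].
Qed.

(** The absolute value changes nothing on the triangle and gives an integrand nonnegative on the
    whole plane, as the change of variables requires. *)
Lemma triangle_mu_sub (A : set (plane R)) : measurable A -> A `<=` T ->
  mu A = \int[L2]_(z in A) `|triangle_density z|%:E.
Proof.
move=> mA AT; rewrite triangle_muE// (setIidl AT); apply: eq_integral => z.
by rewrite inE => /AT Tz; rewrite ger0_norm// triangle_density_ge0.
Qed.

Lemma measurable_normr_density :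
  measurable_fun [set: plane R] (fun z => `|triangle_density z|%:E).
Proof.
apply/measurable_EFinP; apply: (measurableT_comp (@normr_measurable R setT)).
exact: measurable_triangle_density.
Qed.

Lemma triangle_base_measurable : measurable [set z : plane R | z.2 = 0%R].
Proof.
rewrite (_ : [set z | _] = snd @^-1` [set 0%R : MR])//.
rewrite -[X in measurable X]setTI.
by apply: measurable_snd => //; exact: measurable_set1.
Qed.

Lemma triangle_base_null : L2 [set z : plane R | z.2 = 0%R] = 0.
Proof.
rewrite /product_measure1 integral0_eq// => x _ /=.
rewrite (_ : xsection _ _ = [set 0%R]) ?lebesgue_measure_set1//.
by apply/seteqP; split => y /=; rewrite /xsection /= inE.
Qed.

Lemma lebesgue_triangle_lty : L2 T < +oo.
Proof.
have mI : measurable (`[0%R, 1%R]%classic : set MR) by exact: measurable_itv.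
apply: (@le_lt_trans _ _ (L2 (`[0%R, 1%R] `*` `[0%R, 1%R]))).
  apply: le_measure; rewrite ?inE; [exact: measurable_triangle|exact: measurableX|].
  move=> [x y] [/= x1 [yx y0]]; rewrite !in_itv/=.
  by split; apply/andP; split => //; [apply: le_trans yx|apply: le_trans x1].
by rewrite product_measure1E//= lebesgue_measure_itv/= lte_fin ltr01 oppr0 adde0 mule1 ltry.
Qed.

(** On the triangle [h] vanishes only where [y = 0], since [x = 0] forces [y = 0], and that segment
    is Lebesgue null. *)
Lemma triangle_mu_eq0 (A : set (plane R)) : measurable A -> A `<=` T ->
  mu A = 0 <-> L2 A = 0.
Proof.
move=> mA AT; rewrite triangle_mu_sub//; split => [|A0]; last first.
  rewrite (@ge0_negligible_integral _ _ _ _ A A)// ?setDv ?integral_set0//.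
  exact: measurable_funTS measurable_normr_density.
move=> I0; have /ae_eq_integral_abs : measurable_fun A (fun z : plane R => `|triangle_density z|%:E).
  exact: measurable_funTS measurable_normr_density.
move=> /(_ L2 mA) [+ _]; under eq_integral do rewrite abse_EFin normr_id.
move=> /(_ I0) [N [mN N0 AN]].
apply: (@subset_measure0 _ _ _ L2 A (N `|` [set z : plane R | z.2 = 0%R])) => //.
- by apply: measurableU => //; exact: triangle_base_measurable.
- move=> z Az; have [z0|z0] := eqVneq z.2 0%R; [by right|left].
  apply: AN => /= /(_ Az) [] /eqP; rewrite normr_eq0 invr_eq0 mulf_eq0 (negbTE z0) orbF.
  move=> /eqP z1; have [_ [z21 z20]] := AT _ Az.
  by move/eqP: z0; apply; apply/eqP; rewrite eq_le z20 andbT -z1.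
- apply/eqP; rewrite eq_le measure_ge0 andbT (le_trans (measureU2 _ _ _))//.
    exact: triangle_base_measurable.
  by rewrite [X in X + _]N0 [X in _ + X]triangle_base_null adde0.
Qed.

(** At the two preimages of [(u, v)] the density is [(1 + v)^2 / u] and [(1 + v)^2 / (u v)]. The sum
    is [(1 + v)^3 / (u v)], and the Jacobian cancels the cube. *)
Lemma triangle_mu_invariant : invariant_measure T S mu.
Proof.
move=> A mA AT.
have mGS b : measurable (Gamma b `&` S @^-1` A).
  by apply: measurableI; [exact: measurable_Gamma|exact: preimage_measurable].
have mk := measurable_normr_density.
have -> : T `&` S @^-1` A = (Gamma true `&` S @^-1` A) `|` (Gamma false `&` S @^-1` A).
  rewrite -setIUl; congr (_ `&` _); rewrite /Gamma /Gamma1 setUC setDKU//.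
  exact: Gamma0_sub_triangle.
rewrite measureU//; last first.
  by rewrite -subset0 => z [[/= G _] [[_ nG] _]].
have cv b : mu (Gamma b `&` S @^-1` A) =
    \int[L2]_(w in A) (`|triangle_density (branch b w)|%:E * ((1 + w.2) ^- 3)%:E).
  rewrite triangle_mu_sub// => [|z [/Gamma_sub_triangle//]].
  by rewrite triangle_map_change_of_variables// => z; rewrite lee_fin.
rewrite [X in (X + _)%R]cv [X in (_ + X)%R]cv (triangle_mu_sub mA AT).
have m3 : measurable_fun [set: plane R] (fun w => `|(1 + w.2) ^- 3|%:E).
  apply/measurable_EFinP; apply: (measurableT_comp (@normr_measurable R setT)).
  apply: (measurableT_comp (@measurable_inv R)); apply: measurable_funX.
  exact: measurable_funD.
pose F b w := `|triangle_density (branch b w)|%:E * `|(1 + (w : plane R).2) ^- 3|%:E.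
have mF b : measurable_fun setT (F b).
  by apply: emeasurable_funM => //; exact: (measurableT_comp mk (@measurable_branch _ b)).
have F0 b w : 0 <= F b w by rewrite mule_ge0// lee_fin.
have FE b : \int[L2]_(w in A)
    (`|triangle_density (branch b w)|%:E * ((1 + w.2) ^- 3)%:E) = \int[L2]_(w in A) F b w.
  apply: eq_integral => -[u v]; rewrite inE => /AT[/= u1 [vu v0]].
  by rewrite /F /= [`|(1 + v) ^- 3|%R]ger0_norm// invr_ge0 exprn_ge0//; lra.
rewrite !FE -ge0_integralD//; last 2 first.
- exact: measurable_funTS.
- exact: measurable_funTS.
(* The pointwise identity fails at [v = 0], where the inverse of zero is zero by convention; the
   base is removed on both sides. *)
rewrite (@ge0_negligible_integral _ _ _ _ A [set z : plane R | z.2 = 0%R])//; last 4 first.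
- exact: triangle_base_measurable.
- by apply: measurable_funTS; exact: emeasurable_funD.
- by move=> z _; exact: adde_ge0.
- exact: triangle_base_null.
rewrite [RHS](@ge0_negligible_integral _ _ _ _ A [set z : plane R | z.2 = 0%R])//; last 3 first.
- exact: triangle_base_measurable.
- exact: measurable_funTS.
- exact: triangle_base_null.
apply: eq_integral => -[u v]; rewrite inE => -[/AT[/= u1 [vu v0]] /= /eqP vn0].
have v0' : (0 < v)%R by rewrite lt_neqAle eq_sym vn0.
have u0' : (0 < u)%R by rewrite (lt_le_trans v0').
have v1 : (0 < 1 + v)%R by lra.
rewrite /F /= /triangle_density /=.
rewrite !ger0_norm ?invr_ge0 ?mulr_ge0 ?invr_ge0 ?exprn_ge0 ?ltW//.
rewrite -!EFinM -EFinD; congr (_%:E).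
by field; rewrite !gt_eqF.
Qed.

Lemma triangle_mu_sigma_finite : sigma_finite T mu.
Proof.
pose F (n : nat) := T `&` [set z : plane R | (triangle_density z <= cst n%:R z)%R].
have mF n : measurable (F n).
  apply: measurableI; first exact: measurable_triangle.
  rewrite -[X in measurable X]setTI.
  apply: (@measurable_fun_le _ _ R setT (@triangle_density R) (cst n%:R)) => //.
  exact: measurable_triangle_density.
have FT n : F n `<=` T by move=> z [].
exists F => [|n].
  apply/seteqP; split => [z Tz|z [n _ []//]].
  exists (Num.truncn `|triangle_density z|).+1 => //; split => //=.
  by rewrite (le_trans (ler_norm _))// ltW// truncnS_gt.
split => //; rewrite triangle_mu_sub//.
apply: (@le_lt_trans _ _ (\int[L2]_(z in F n) n%:R%:E)).
  apply: ge0_le_integral => //.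
  - exact: measurable_funTS measurable_normr_density.
  - by move=> z [Tz hz]; rewrite lee_fin ger0_norm// triangle_density_ge0.
rewrite integral_cst//; apply: lte_mul_pinfty => //.
apply: le_lt_trans lebesgue_triangle_lty.
by apply: le_measure; rewrite ?inE//; exact: measurable_triangle.
Qed.

Lemma triangle_mu_Gamma0_lty : mu (@Gamma0 R) < +oo.
Proof.
rewrite triangle_mu_sub; [|exact: measurable_Gamma0|exact: Gamma0_sub_triangle].
(* On [Gamma0] one has [x > 1/2], hence [h <= 2 / y]. [B] contains [Gamma0] and has the section
   [[1 - y, 1]] at height [y], of length [y], so each section contributes 2. *)
pose B : set (plane R) := [set z | 1 - z.2 <= z.1 /\ z.1 <= 1 /\ 0 < z.2 /\ z.2 <= 1]%R.
have mB : measurable B.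
  have m1 : measurable_fun [set: plane R] (fun z => 1 - z.2 : R)%R by exact: measurable_funB.
  rewrite (_ : B = (([set: plane R] `&` [set z | 1 - z.2 <= z.1]%R) `&`
    ([set: plane R] `&` [set z | z.1 <= cst 1%R z]%R)) `&`
    (([set: plane R] `&` [set z | z.2 <= cst 1%R z]%R) `\`
    ([set: plane R] `&` [set z | z.2 <= cst 0%R z]%R))); last first.
    rewrite !setTI; apply/seteqP; split => z /=.
      move=> [h1 [h2 [h3 h4]]]; do !split => //.
      by apply/negP; rewrite -ltNge.
    by move=> [[h1 h2] [h3 /negP]]; rewrite -ltNge.
  apply: measurableI; first apply: measurableI; last apply: measurableD.
  - exact: (measurable_fun_le measurableT m1 measurable_fst).
  - exact: (@measurable_fun_le _ _ R setT fst (cst 1%R)).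
  - exact: (@measurable_fun_le _ _ R setT snd (cst 1%R)).
  - exact: (@measurable_fun_le _ _ R setT snd (cst 0%R)).
pose g (z : plane R) := `|2 * z.2^-1|%:E * (\1_B z)%:E.
have mg2 : measurable_fun [set: plane R] (fun z => `|2 * z.2^-1|%:E).
  apply/measurable_EFinP; apply: (measurableT_comp (@normr_measurable R setT)).
  apply: measurable_funM => //.
  exact: (measurableT_comp (@measurable_inv R) measurable_snd).
have mg : measurable_fun setT g.
  apply: emeasurable_funM => //.
  by apply/measurable_EFinP; exact: measurable_indic.
have g0 z : 0 <= g z by rewrite mule_ge0// lee_fin.
apply: (@le_lt_trans _ _ (\int[L2]_z g z)).
  apply: (@le_trans _ _ (\int[L2]_(z in @Gamma0 R) g z)); last first.
    by apply: ge0_subset_integral => //; exact: measurable_Gamma0.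
  apply: ge0_le_integral => //.
  - exact: measurable_Gamma0.
  - exact: measurable_funTS measurable_normr_density.
  - exact: measurable_funTS.
  - move=> [x y] [/= x1 [yx xy]]; have y0 : (0 < y)%R by lra.
    have x0 : (0 < x)%R by lra.
    rewrite /g indicE mem_set; last by rewrite /B/=; do !split; lra.
    rewrite mule1 lee_fin /triangle_density /= !gtr0_norm ?invr_gt0 ?mulr_gt0 ?invr_gt0//.
    rewrite invfM ler_pM2r ?invr_gt0//.
    by rewrite -[leRHS]invrK lef_pV2 ?posrE ?invr_gt0//; lra.
rewrite fubini_tonelli2//.
apply: (@le_lt_trans _ _ (\int[L]_(y in `]0%R, 1%R]) 2%:E)); last first.
  by rewrite integral_cst//= lebesgue_measure_itv/= lte_fin ltr01 oppr0 adde0 mule1 ltry.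
rewrite [leRHS]integral_mkcond; apply: ge0_le_integral => //.
- by move=> y _; exact: integral_ge0.
- exact: measurable_fun_fubini_tonelli_G.
- by apply/(measurable_restrict _ _ _) => //; exact: measurable_cst.
move=> y _; rewrite patchE; case: ifPn => [|yN]; last first.
  rewrite /fubini_G integral0_eq// => x _; rewrite /g indicE memNset ?mule0//.
  move=> [/= _ [_ [y0 y1]]]; move/negP: yN; apply.
  by rewrite inE/= in_itv/= y0.
rewrite inE/= in_itv/= => /andP[y0 y1].
rewrite /fubini_G (_ : \int[L]_x g (x, y) = \int[L]_(x in `[(1 - y)%R, 1%R]) `|2 * y^-1|%:E).
  rewrite integral_cst//= lebesgue_measure_itv/= lte_fin ifT; last by lra.
  rewrite gtr0_norm ?mulr_gt0 ?invr_gt0// -EFinB -EFinM lee_fin opprB addrCA subrr addr0.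
  by rewrite -mulrA mulVf ?gt_eqF// mulr1.
rewrite [RHS]integral_mkcond; apply: eq_integral => x _.
rewrite epatch_indic /g/=; congr (_ * (_%:R)%:E); congr nat_of_bool.
apply/idP/idP; rewrite !inE /B /= in_itv/=; first by move=> [-> [-> _]].
by move=> /andP[-> ->].
Qed.

Lemma triangle_mu_triangle : mu T = +oo.
Proof.
apply/eqyP => A A0.
(* The [n]-th box has area [2 ^- (n + 3)] and density at least [2 ^ (n + 1)], hence mass at least
   1/4; the boxes are disjoint and accumulate at the base. *)
pose B (n : nat) : set (plane R) := `]2^-1%R, 1%R]%classic `*` `](2 ^- n.+2)%R, (2 ^- n.+1)%R]%classic.
have mB n : measurable (B n) by apply: measurableX; exact: measurable_itv.
have p0 n : (0 < 2 ^- n :> R)%R by rewrite invr_gt0 exprn_gt0.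
have p2 n : (2 ^- n.+1 = 2 ^- n / 2 :> R)%R by rewrite exprSr invfM.
have p1 n : (2 ^- n <= 1 :> R)%R by rewrite invf_le1 ?exprn_gt0// exprn_ege1// ler1n.
have BT n : B n `<=` T.
  move=> [x y] [/=]; rewrite !in_itv/= => /andP[x1 x2] /andP[y1 y2].
  have := p2 n; have := p1 n; have := p0 n.+2.
  by rewrite /triangle/=; do !split => //; lra.
have muB n : (4^-1)%:E <= mu (B n).
  rewrite triangle_mu_sub//.
  apply: (@le_trans _ _ (\int[L2]_(z in B n) (2 ^+ n.+1)%:E)); last first.
    apply: ge0_le_integral => //.
    - exact: measurable_funTS measurable_normr_density.
    - move=> [x y] [/=]; rewrite !in_itv/= => /andP[x1 x2] /andP[y1 y2].
      have y0 : (0 < y)%R by rewrite (lt_trans _ y1).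
      have x0 : (0 < x)%R by lra.
      rewrite lee_fin gtr0_norm /triangle_density ?invr_gt0 ?mulr_gt0//=.
      rewrite -[leLHS]invrK lef_pV2 ?posrE ?mulr_gt0//.
      by apply: le_trans y2; rewrite -[leRHS]mul1r ler_pM2r.
  rewrite integral_cst//= /B product_measure1E//=.
  rewrite /= !lebesgue_measure_itv/= !lte_fin ifT; last by lra.
  rewrite ifT; last by have := p2 n.+1; have := p0 n.+1; lra.
  rewrite -!EFinB -!EFinM lee_fin (p2 n.+1).
  have e : (2 ^+ n.+1 * 2 ^- n.+1 = 1 :> R)%R by rewrite divff// expf_neq0.
  by move: (2 ^+ n.+1)%R (2 ^- n.+1)%R e => a c e; nra.
have tB : trivIset setT B.
  apply: ltn_trivIset => n2 n1 n21; rewrite -subset0 => -[x y] [[_ /=] ] + [_ /=].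
  rewrite !in_itv/= => /andP[y1 y2] /andP[y3 y4].
  have : (2 ^- n2.+1 <= 2 ^- n1.+2 :> R)%R.
    by rewrite lef_pV2 ?posrE ?exprn_gt0// ler_weXn2l// ler1n.
  lra.
pose N := (Num.truncn (4 * A)).+1.
apply: (@le_trans _ _ (\sum_(n < N) mu (B n))).
  apply: (@le_trans _ _ (\sum_(n < N) (4^-1)%:E)); last by apply: lee_sum => n _; exact: muB.
  rewrite sumEFin lee_fin sumr_const card_ord.
  have : (4 * A < N%:R)%R by rewrite truncnS_gt.
  by rewrite -mulr_natl; lra.
rewrite -measure_bigsetU//; apply: le_measure; rewrite ?inE//.
- by apply: bigsetU_measurable => n _; exact: mB.
- exact: measurable_triangle.
by rewrite -bigcup_mkord; apply: bigcup_sub => n _; exact: BT.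
Qed.

End triangle_measures.

(** * Conservative systems *)

Section limsup.
Context d (T : measurableType d) (R : realType).
Local Open Scope ereal_scope.

Lemma lim_sup_set_bounded_sum (mu : {measure set T -> \bar R}) (F : (set T)^nat)
    (M : \bar R) :
  (forall n, measurable (F n)) -> M < +oo ->
  (forall n, \sum_(k < n) mu (F k) <= M) -> mu (lim_sup_set F) = 0.
Proof.
move=> mF Moo sM; apply: lim_sup_set_cvg0 => //.
apply: le_lt_trans Moo; apply: lime_le; first exact: is_cvg_nneseries.
by apply: nearW => n; rewrite big_mkord.
Qed.

End limsup.

Section dynamics.
Context d (T : measurableType d) (R : realType).
Variables (X : set T) (f : T -> T) (mu : {measure set T -> \bar R}).
Hypotheses (mX : measurable X) (mf : measurable_fun setT f).
Hypothesis (fX : set_fun X X f).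
Local Open Scope ereal_scope.
Local Notation pre n A := (X `&` iter n f @^-1` A).

Lemma iter_set_fun n : set_fun X X (iter n f).
Proof. by elim: n => [|n IH] z Xz //=; apply: fX; exact: IH. Qed.

Lemma preimage_iter_measurable n A : measurable A -> measurable (pre n A).
Proof.
move=> mA; apply: measurableI => //; rewrite -[X in measurable X]setTI.
suff : measurable_fun setT (iter n f) by exact.
elim: n => [|n IH]; [exact: measurable_id|exact: (measurableT_comp mf IH)].
Qed.

Lemma pre_iterSr n A : pre n.+1 A = X `&` f @^-1` (pre n A).
Proof.
apply/seteqP; split => z /= [Xz]; rewrite -iterS iterSr //; last by move=> [].
by move=> fA; split => //; split => //; exact: fX.
Qed.

Lemma pre_iterD m n A : pre (m + n) A = pre m (pre n A).
Proof.
apply/seteqP; split => z /= [Xz]; rewrite addnC iterD; last by move=> [].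
by move=> fA; split => //; split => //; exact: iter_set_fun.
Qed.

Hypothesis mu_inv : invariant_measure X f mu.

Lemma invariant_measure_iter n A : measurable A -> A `<=` X -> mu (pre n A) = mu A.
Proof.
move=> mA AX; elim: n => [|n IH]; first by rewrite setIidr.
by rewrite pre_iterSr mu_inv//; exact: preimage_iter_measurable.
Qed.

Variable A : set T.
Hypotheses (mA : measurable A) (AX : A `<=` X) (muA : mu A < +oo).
Hypothesis sweep : mu (X `\` lim_sup_set (fun n => pre n A)) = 0.

Lemma measurable_lim_sup_pre : measurable (lim_sup_set (fun n => pre n A)).
Proof.
apply: bigcap_measurable => // n _; apply: bigcup_measurable => k _.
exact: preimage_iter_measurable.
Qed.

(** Almost every point of [W] meets [A] infinitely often, hence lies in the limit superior. The
    shift [k] allows visits to be counted from a later time. *)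
Lemma null_of_lim_sup (W : set T) (k : nat) : measurable W -> W `<=` X ->
  mu (lim_sup_set (fun n => W `&` pre (n + k) A)) = 0 -> mu W = 0.
Proof.
move=> mW WX W0.
have mL : measurable (lim_sup_set (fun n => W `&` pre (n + k) A)).
  apply: bigcap_measurable => // n _; apply: bigcup_measurable => j _.
  by apply: measurableI => //; exact: preimage_iter_measurable.
have mN : measurable (X `\` lim_sup_set (fun n => pre n A)).
  by apply: measurableD => //; exact: measurable_lim_sup_pre.
apply: (@subset_measure0 _ _ _ mu W (lim_sup_set (fun n => W `&` pre (n + k) A) `|`
    (X `\` lim_sup_set (fun n => pre n A)))) => //.
- exact: measurableU.
- move=> z Wz.
  have [zV|zV] := pselect (lim_sup_set (fun n => pre n A) z); last first.
    by right; split => //; exact: WX.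
  left=> n _; have [j /= nj zj] := zV (n + k)%N I.
  exists (j - k)%N; first by rewrite /= leq_subRL 1?addnC// (leq_trans _ nj)// leq_addl.
  by split => //; rewrite subnK// (leq_trans _ nj)// leq_addl.
- exact: null_set_setU.
Qed.

(** Pulled back by the iterate of order [n - k], the part of [W] visiting [A] at time [k] becomes
    [F (n - k)]. These sets are disjoint because [W] is wandering, and they all lie in [pre n A], of
    measure [mu A]; so the visits of [W] to [A] have measures of bounded sum. *)
Lemma sweep_conservative : conservative X f mu.
Proof.
move=> W [mW WX tW].
apply: (@null_of_lim_sup W 0) => //.
apply: (@lim_sup_set_bounded_sum _ _ _ _ _ (mu A)) => //.
  by move=> n; apply: measurableI => //; exact: preimage_iter_measurable.
case=> [|n]; first by rewrite big_ord0.
pose F k := pre k W `&` pre n A.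
have mF k : measurable (F k).
  by apply: measurableI; exact: preimage_iter_measurable.
have FE (k : 'I_n.+1) : mu (W `&` pre (k + 0) A) = mu (F (rev_ord k)).
  rewrite addn0 /= subSS -(@invariant_measure_iter (n - k))//; last 2 first.
  - by apply: measurableI => //; exact: preimage_iter_measurable.
  - by move=> z [/WX].
  congr (mu _); have kn : (k <= n)%N by rewrite -ltnS.
  have -> : F (n - k)%N = pre (n - k) W `&` pre (n - k) (pre k A).
    by rewrite -pre_iterD subnK.
  by apply/seteqP; split => z /=; tauto.
under eq_bigr do rewrite FE.
have -> : \sum_(k < n.+1) mu (F (rev_ord k)) = \sum_(k < n.+1) mu (F k).
  by rewrite [RHS](reindex_inj rev_ord_inj).
rewrite -measure_bigsetU//; last first.
  by apply: sub_trivIset; [|exact: trivIset_setIr tW].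
rewrite -[leRHS](@invariant_measure_iter n A)//; apply: le_measure; rewrite ?inE.
- by apply: bigsetU_measurable => k _; exact: mF.
- exact: preimage_iter_measurable.
- by rewrite -bigcup_mkord; apply: bigcup_sub => k _ z [].
Qed.

(** If almost no point leaves [P], then almost no point enters it: apart from orbits meeting [Z], a
    point that enters [P] never comes out, so the set of entering points is wandering, hence null.
    [P] then agrees almost everywhere with an exactly invariant set. *)
Lemma ergodic_almost_invariant (P : set T) : ergodic X f mu ->
  measurable P -> P `<=` X -> mu (P `\` f @^-1` P) = 0 ->
  mu P = 0 \/ mu (X `\` P) = 0.
Proof.
move=> erg mP PX Z0.
have mfI B : measurable B -> measurable (f @^-1` B).
  by move=> mB; rewrite -[X in measurable X]setTI; exact: mf.
pose Z := P `\` f @^-1` P; have mZ : measurable Z by apply: measurableD; last exact: mfI.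
have ZX : Z `<=` X by move=> z [/PX].
pose W := (X `&` f @^-1` P) `\` P.
have mW : measurable W by apply: measurableD => //; apply: measurableI => //; exact: mfI.
have WX : W `<=` X by move=> z [[]].
have cover_null B : measurable B -> B `<=` X -> mu B = 0 -> mu (\bigcup_n pre n B) = 0.
  move=> mB BX B0; apply/eqP; rewrite eq_le measure_ge0 andbT.
  apply: le_trans; first apply: (@measure_sigma_subadditive _ _ _ mu _ (fun n => pre n B)) => //.
  - by move=> n; exact: preimage_iter_measurable.
  - by apply: bigcup_measurable => n _; exact: preimage_iter_measurable.
  - by rewrite eseries0// => n _ _; rewrite invariant_measure_iter.
have mC B : measurable B -> measurable (\bigcup_n pre n B).
  by move=> mB; apply: bigcup_measurable => n _; exact: preimage_iter_measurable.
have W0 : mu W = 0.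
  apply: (@subset_measure0 _ _ _ mu W ((W `\` \bigcup_n pre n Z) `|` \bigcup_n pre n Z)) => //.
  - by apply: measurableU; [apply: measurableD|]; rewrite //; exact: mC.
  - by move=> z Wz; have [|] := pselect ((\bigcup_n pre n Z) z); [right|left].
  apply: null_set_setU; [by apply: measurableD => //; exact: mC|exact: mC| |exact: cover_null].
  apply: sweep_conservative; split.
  - by apply: measurableD => //; exact: mC.
  - by move=> z [/WX].
  (* The orbit is in [P] at time [j + 1] and cannot leave it, so it is not outside [P] at the later
     time [k]. *)
  apply: ltn_trivIset => k j jk; rewrite -subset0 => z [[Xz [Wj nZ]] [_ [[_ nP] _]]].
  apply: nP; have {}nZ i : ~ Z (iter (i + j) f z).
    move=> Zi; apply: nZ; exists i => //; split; first exact: iter_set_fun.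
    by rewrite /= -iterD.
  rewrite -(subnK jk); elim: (k - j.+1)%N => [|i IH]; first by case: Wj => [[]].
  rewrite addSn /=; apply: contrapT => nP; apply: (nZ i.+1).
  by rewrite addSnnS; split.
(* Visiting [P] infinitely often is an exactly invariant property, as [ergodic] demands, and off the
   null set [B] it amounts to lying in [P]. *)
pose E := X `&` [set z | forall n, exists2 m, (n <= m)%N & P (iter m f z)].
pose B := (\bigcup_n pre n Z) `|` (\bigcup_n pre n W).
have mB : measurable B by apply: measurableU; exact: mC.
have B0 : mu B = 0.
  by apply: null_set_setU; [exact: mC|exact: mC|exact: cover_null|exact: cover_null].
have mE : measurable E.
  rewrite (_ : E = lim_sup_set (fun n => pre n P)).
    apply: bigcap_measurable => // n _; apply: bigcup_measurable => k _.
    exact: preimage_iter_measurable.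
  apply/seteqP; split => z.
    by move=> [Xz zP] n _; have [m nm Pm] := zP n; exists m.
  move=> zL; have [m _ [Xz _]] := zL 0%N I; split => // n.
  by have [k nk [_ Pk]] := zL n I; exists k.
have EX : E `<=` X by move=> z [].
have Einv : X `&` f @^-1` E = E.
  apply/seteqP; split => z.
    move=> [Xz [_ fE]]; split => // n; have [m nm Pm] := fE n.
    by exists m.+1; [exact: leqW|rewrite iterSr].
  move=> [Xz zE]; split => //; split; first exact: fX.
  move=> n; have [[|m] //] := zE n.+1; rewrite ltnS => nm Pm.
  by exists m => //; rewrite -iterSr.
have EP z : X z -> ~ B z -> (E z <-> P z).
  move=> Xz nB.
  have PP n : P (iter n f z) <-> P z.
    elim: n => // n IH; rewrite -IH; split => Pn.
      apply: contrapT => nP; apply: nB; right; exists n => //; split => //.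
      by split => //; split => //; exact: iter_set_fun.
    apply: contrapT => nP; apply: nB; left; exists n => //; split => //.
  split=> [[_ /(_ 0%N)[m _ /PP]]//|Pz]; split => // n; exists n => //.
  exact/PP.
have [E0|E0] := erg E mE EX Einv; [left|right].
- apply: (@subset_measure0 _ _ _ mu P (E `|` B)) => //; first exact: measurableU.
    move=> z Pz; have [|nB] := pselect (B z); first by right.
    by left; apply/EP => //; exact: PX.
  exact: null_set_setU.
- apply: (@subset_measure0 _ _ _ mu (X `\` P) ((X `\` E) `|` B)) => //.
  + exact: measurableD.
  + by apply: measurableU => //; exact: measurableD.
  + move=> z [Xz nP]; have [|nB] := pselect (B z); first by right.
    by left; split => // /(EP _ Xz nB).
  + by apply: null_set_setU => //; exact: measurableD.
Qed.

Variable nu : {measure set T -> \bar R}.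
Hypothesis nu_inv : invariant_measure X f nu.

(** Points of [P'] whose image falls outside [P] make [rho] drop by at least [e mu]. Since
    [rho A <= c mu A] is finite, the drops along the preimages of [A] have a bounded sum, and
    recurrence makes the set of such points null. *)
Lemma strict_excess_null (P P' : set T) (c e : R) :
  (0 <= c)%R -> (0 < e)%R ->
  measurable P -> P `<=` X -> measurable P' -> P' `<=` P ->
  (forall B, measurable B -> B `<=` X `\` P -> nu B <= c%:E * mu B) ->
  (forall B, measurable B -> B `<=` P -> c%:E * mu B <= nu B) ->
  (forall B, measurable B -> B `<=` P' -> (c + e)%:E * mu B <= nu B) ->
  mu (P' `\` f @^-1` P) = 0.
Proof.
move=> c0 e0 mP PX mP' P'P nuN nuP nuP'.
have mfI B : measurable B -> measurable (f @^-1` B).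
  by move=> mB; rewrite -[X in measurable X]setTI; exact: mf.
(* [rho] is the minimum of [nu] and [c mu], so it can only decrease under [f] *)
pose rho B := nu (B `\` P) + c%:E * mu (B `&` P).
have rho_mu B : measurable B -> B `<=` X -> rho B <= c%:E * mu B.
  move=> mB BX; rewrite [in leRHS](measureDI mu mB mP) ge0_muleDr//.
  apply: leeD => //; apply: nuN; first exact: measurableD.
  by move=> z [/BX].
have rhoD B C : measurable B -> measurable C -> B `&` C = set0 ->
    rho (B `|` C) = rho B + rho C.
  move=> mB mC BC; rewrite /rho setDUl setIUl !measureU//; last 6 first.
  - exact: measurableI.
  - exact: measurableI.
  - by rewrite setIACA BC set0I.
  - exact: measurableD.
  - exact: measurableD.
  - by rewrite !setDE setIACA BC set0I.
  rewrite ge0_muleDr// addeACA//.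
set W := P' `\` f @^-1` P.
have mW : measurable W by apply: measurableD => //; exact: mfI.
have WX : W `<=` X by move=> z [/P'P/PX].
(* The preimage of [B] is cut by where it lands. Over [B] outside [P], the mass [nu] is carried back
   unchanged, whereas [rho] charges only [c mu] inside [P], a loss of at least [e mu] on [P']. Over
   [B] inside [P], the mass [c mu] is carried back and dominates [rho]. *)
have step B : measurable B -> B `<=` X ->
    e%:E * mu (W `&` f @^-1` B) + rho (X `&` f @^-1` B) <= rho B.
  move=> mB BX.
  set C := X `&` f @^-1` (B `\` P); set C' := X `&` f @^-1` (B `&` P).
  have mC : measurable C by apply: measurableI => //; apply: mfI; exact: measurableD.
  have mC' : measurable C' by apply: measurableI => //; apply: mfI; exact: measurableI.
  have -> : X `&` f @^-1` B = C `|` C'.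
    by apply/seteqP; split => z /=; rewrite /C/C'/=; have := EM (P (f z)); tauto.
  rewrite rhoD//; last first.
    by apply/seteqP; split => z //=; rewrite /C/C'/=; tauto.
  rewrite addeA {2}/rho; apply: leeD; last first.
    apply: le_trans (rho_mu _ mC' _) _; first by move=> z [].
    rewrite /C' mu_inv//; first exact: measurableI.
    by move=> z [/BX].
  rewrite -(nu_inv (A := B `\` P)); [|exact: measurableD|by move=> z [/BX]].
  rewrite -/C (measureDI nu mC mP) /rho addeCA; apply: leeD => //.
  have mCP : measurable (C `&` P) by exact: measurableI.
  rewrite (measureDI nu mCP mP') (measureDI mu mCP mP').
  have CP' : C `&` P `&` P' = W `&` f @^-1` B.
    by apply/seteqP; split => z; rewrite /C/W/=; have := @P'P z; have := @PX z; tauto.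
  rewrite CP' ge0_muleDr// addeCA; apply: leeD.
    by apply: nuP; [exact: measurableD|move=> z [[]]].
  rewrite -ge0_muleDl ?lee_fin//; last exact: ltW.
  rewrite -EFinD addrC; apply: nuP'; last by move=> z [[]].
  by rewrite -CP'; exact: measurableI.
(* The shift is 1 because the [n]-th drop is measured on the points of [W] whose image lies in
   [pre n A]. *)
apply: (@null_of_lim_sup W 1) => //.
apply: (@lim_sup_set_bounded_sum _ _ _ _ _ ((e^-1)%:E * (c%:E * mu A))) => //.
- by move=> n; apply: measurableI => //; exact: preimage_iter_measurable.
- by rewrite lte_mul_pinfty// ?lee_fin ?invr_ge0 ?(ltW e0)// lte_mul_pinfty.
move=> n; rewrite -[leLHS]mul1e -(@mulVf _ e) ?gt_eqF// EFinM -muleA.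
rewrite lee_wpmul2l ?lee_fin ?invr_ge0 ?(ltW e0)//.
suff : e%:E * \sum_(k < n) mu (W `&` pre (k + 1) A) + rho (pre n A) <= rho (pre 0 A).
  move=> H; apply: le_trans (rho_mu _ mA AX).
  have e0A : pre 0 A = A by rewrite setIidr.
  rewrite e0A in H; apply: le_trans H; rewrite leeDl//.
  by rewrite adde_ge0// mule_ge0.
elim: n => [|n IH]; first by rewrite big_ord0 mule0 add0e.
apply: le_trans IH; rewrite big_ord_recr/= ge0_muleDr//; last by apply: sume_ge0.
rewrite -addeA leeD2l//.
have := step (pre n A) (preimage_iter_measurable n mA) (@subIsetl _ _ _).
rewrite -pre_iterSr addn1; congr (_ + _ <= _); congr (_ * mu _).
rewrite pre_iterSr; apply/seteqP; split => z /=; have := @WX z; tauto.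
Qed.

End dynamics.

(** * Uniqueness of the invariant measure *)

Lemma bigcup_null d (T : measurableType d) (R : realType)
    (mu : {measure set T -> \bar R}) (F : (set T)^nat) :
  (forall n, measurable (F n)) -> (forall n, mu (F n) = 0%E) ->
  mu (\bigcup_n F n) = 0%E.
Proof.
move=> mF F0; apply/eqP; rewrite eq_le measure_ge0 andbT.
apply: le_trans; first apply: (@measure_sigma_subadditive _ _ _ mu _ F) => //.
  exact: bigcup_measurable.
by rewrite eseries0// => n _ _; rewrite F0.
Qed.

Section uniqueness.
Context d (T : measurableType d) (R : realType).
Local Open Scope ereal_scope.

(** Radon-Nikodym applies to the finite restrictions of [nu] to disjoint pieces of [X], and the
    densities are summed; the sum is an extended real. *)
Lemma sigma_finite_density (X : set T) (mu : {sigma_finite_measure set T -> \bar R})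
    (nu : {measure set T -> \bar R}) :
  sigma_finite X nu ->
  (forall B, measurable B -> B `<=` X -> mu B = 0 -> nu B = 0) ->
  exists g : T -> \bar R, [/\ measurable_fun setT g, forall x, 0 <= g x &
    forall B, measurable B -> B `<=` X -> nu B = \int[mu]_(x in B) g x].
Proof.
move=> [F XF /all_and2[mF Foo]] numu.
pose G := seqDU F.
have mG n : measurable (G n) by exact: seqDU_measurable.
have Goo n : nu (G n) < +oo.
  by apply: le_lt_trans (Foo n); apply: le_measure; rewrite ?inE//; exact: subset_seqDU.
have XG : X = \bigcup_n G n by rewrite XF seqDU_bigcup_eq.
have tG : trivIset setT G := @trivIset_seqDU _ F.
pose nu_ n : {finite_measure set T -> \bar R} := mfrestr (mG n) (Goo n).
have nu_mu n : nu_ n `<< mu.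
  apply/null_content_dominatesP => B mB B0; rewrite /nu_ /= /mfrestr /mrestr.
  apply: numu; [exact: measurableI| |].
    by move=> x [_ Gx]; rewrite XG; exists n.
  by apply: (@subset_measure0 _ _ _ mu (B `&` G n) B) => //; exact: measurableI.
have /choice[g gP] n := radon_nikodym_sigma_finite (nu_mu n).
have g0 n x : 0 <= g n x by have [] := gP n.
have mg n : measurable_fun setT (g n) by have [_ _ /measurable_int] := gP n.
exists (fun x => \sum_(n <oo) g n x); split.
- by apply: ge0_emeasurable_sum.
- by move=> x; exact: nneseries_ge0.
move=> B mB BX.
rewrite integral_nneseries//; last by move=> n; exact: measurable_funTS.
have -> : nu B = \sum_(n <oo) nu (B `&` G n).
  rewrite -[in LHS](setIidl BX) XG setI_bigcupr measure_semi_bigcup//.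
  - by move=> n; exact: measurableI.
  - exact: trivIset_setIl.
  - by apply: bigcup_measurable => n _; exact: measurableI.
by apply: eq_eseriesr => n _; have [_ _ _ <-] := gP n.
Qed.

(** [B0] fixes the only possible constant [c0 = nu B0 / mu B0] and decides the dichotomy for every
    other [c]. Letting [c] tend to [c0] gives equality on sets of finite [mu], then everywhere by
    countable additivity. *)
Lemma proportional_of_dichotomy (X : set T) (mu nu : {measure set T -> \bar R})
    (B0 : set T) :
  sigma_finite X mu -> measurable B0 -> B0 `<=` X ->
  mu B0 != 0 -> mu B0 < +oo -> nu B0 < +oo -> nu X != 0 ->
  (forall c : R, (0 < c)%R ->
    (forall B, measurable B -> B `<=` X -> nu B <= c%:E * mu B) \/
    (forall B, measurable B -> B `<=` X -> c%:E * mu B <= nu B)) ->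
  exists2 c : R, (0 < c)%R & forall B, measurable B -> B `<=` X -> nu B = c%:E * mu B.
Proof.
move=> [F XF /all_and2[mF Foo]] mB0 B0X muB0 muB0oo nuB0oo nuX dich.
pose G := seqDU F.
have mG n : measurable (G n) by exact: seqDU_measurable.
have Goo n : mu (G n) < +oo.
  by apply: le_lt_trans (Foo n); apply: le_measure; rewrite ?inE//; exact: subset_seqDU.
have XG : X = \bigcup_n G n by rewrite XF seqDU_bigcup_eq.
have tG : trivIset setT G := @trivIset_seqDU _ F.
have splitG (m : {measure set T -> \bar R}) B : measurable B -> B `<=` X ->
    m B = \sum_(n <oo) m (B `&` G n).
  move=> mB BX; rewrite -[in LHS](setIidl BX) XG setI_bigcupr measure_semi_bigcup//.
  - by move=> n; exact: measurableI.
  - exact: trivIset_setIl.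
  - by apply: bigcup_measurable => n _; exact: measurableI.
have muB0f : mu B0 \is a fin_num by rewrite ge0_fin_numE.
have nuB0f : nu B0 \is a fin_num by rewrite ge0_fin_numE.
have m0 : (0 < fine (mu B0))%R by rewrite fine_gt0// muB0oo lt_neqAle eq_sym muB0 measure_ge0.
pose c0 := (fine (nu B0) / fine (mu B0))%R.
have c00 : (0 <= c0)%R by apply: divr_ge0; [exact: fine_ge0|exact: ltW].
have nuB0E : nu B0 = c0%:E * mu B0.
  by rewrite -(fineK muB0f) -(fineK nuB0f) -EFinM /c0 divfK ?gt_eqF.
have upper c : (c0 < c)%R -> forall B, measurable B -> B `<=` X -> nu B <= c%:E * mu B.
  move=> cc; have [//|h] := dich c (le_lt_trans c00 cc).
  have := h _ mB0 B0X; rewrite nuB0E -(fineK muB0f) -!EFinM lee_fin ler_pM2r//.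
  by rewrite leNgt cc.
have lower c : (0 < c)%R -> (c < c0)%R ->
    forall B, measurable B -> B `<=` X -> c%:E * mu B <= nu B.
  move=> cp cc; have [h|//] := dich c cp.
  have := h _ mB0 B0X; rewrite nuB0E -(fineK muB0f) -!EFinM lee_fin ler_pM2r//.
  by rewrite leNgt cc.
have fin B : measurable B -> B `<=` X -> mu B < +oo -> nu B = c0%:E * mu B.
  move=> mB BX Boo.
  have muBf : mu B \is a fin_num by rewrite ge0_fin_numE.
  have nuBf : nu B \is a fin_num.
    rewrite ge0_fin_numE//; apply: le_lt_trans (upper (c0 + 1)%R _ B mB BX) _.
      by rewrite ltrDl.
    by rewrite lte_mul_pinfty// lee_fin; lra.
  rewrite -(fineK muBf) -(fineK nuBf) -EFinM; congr (_%:E).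
  have b0 : (0 <= fine (mu B))%R by exact: fine_ge0.
  have n0 : (0 <= fine (nu B))%R by exact: fine_ge0.
  (* The margin satisfies [q e * b <= e]; the denominator [1 + b] avoids dividing by [b = 0]. *)
  pose b := fine (mu B); pose q e : R := (e / (1 + b))%R.
  have b1 : (0 < 1 + b)%R by rewrite ltr_pwDl.
  have q0 e : (0 < e)%R -> (0 < q e)%R by move=> e0; rewrite divr_gt0.
  have qb e : (0 < e)%R -> (q e * b <= e)%R.
    by move=> e0; rewrite /q mulrAC ler_pdivrMr// ler_pM2l// lerDr.
  apply/eqP; rewrite eq_le; apply/andP; split; apply/ler_addgt0Pr => e e0.
    have := upper (c0 + q e)%R _ B mB BX; rewrite ltrDl q0// => /(_ isT).
    rewrite -(fineK muBf) -(fineK nuBf) -EFinM lee_fin => /le_trans; apply.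
    by rewrite mulrDl lerD2l; exact: qb.
  (* If [c0 <= q e], then [lower] has no positive constant to use, but [c0 * b <= e] makes the bound
     trivial. *)
  rewrite -lerBlDr; have [ec|ec] := ltP (q e) c0; last first.
    rewrite (le_trans _ n0)// subr_le0; apply: le_trans (qb e e0).
    exact: ler_wpM2r.
  have := lower (c0 - q e)%R _ _ B mB BX.
  rewrite subr_gt0 ec ltrBlDr ltrDl q0// => /(_ isT isT).
  rewrite -(fineK muBf) -(fineK nuBf) -EFinM lee_fin; apply: le_trans.
  by rewrite mulrBl lerD2l lerN2; exact: qb.
have E B : measurable B -> B `<=` X -> nu B = c0%:E * mu B.
  move=> mB BX; rewrite (splitG nu)// (splitG mu)// -nneseriesZl//.
  apply: eq_eseriesr => n _; apply: fin; first exact: measurableI.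
    by move=> x [/BX].
  by apply: le_lt_trans (Goo n); apply: le_measure; rewrite ?inE//; exact: measurableI.
exists c0 => //; rewrite lt_neqAle c00 andbT; apply: contra nuX => /eqP c0E.
rewrite E//; last by rewrite XF; exact: bigcup_measurable.
by rewrite -c0E mul0e.
Qed.

Variables (X : set T) (f : T -> T) (mu : {sigma_finite_measure set T -> \bar R}).
Hypotheses (mX : measurable X) (mf : measurable_fun setT f) (fX : set_fun X X f).
Hypotheses (mu_inv : invariant_measure X f mu) (mu_erg : ergodic X f mu).
Variable A : set T.
Hypotheses (mA : measurable A) (AX : A `<=` X) (muA : mu A < +oo).
Hypothesis sweep : mu (X `\` lim_sup_set (fun n => X `&` iter n f @^-1` A)) = 0.
Hypothesis muX : sigma_finite X mu.
Variable nu : {measure set T -> \bar R}.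
Hypotheses (nuX : sigma_finite X nu) (nu_inv : invariant_measure X f nu).
Hypothesis numu : forall B, measurable B -> B `<=` X -> mu B = 0 -> nu B = 0.

Lemma invariant_dichotomy (c : R) : (0 < c)%R ->
  (forall B, measurable B -> B `<=` X -> nu B <= c%:E * mu B) \/
  (forall B, measurable B -> B `<=` X -> c%:E * mu B <= nu B).
Proof.
move=> c0; have [g [mg g0 nuE]] := sigma_finite_density nuX numu.
pose P := X `&` [set x | c%:E < g x].
(* The strict excess [g > c] is exhausted by levels with a uniform margin, the [e] of
   [strict_excess_null]. *)
pose P' k := X `&` [set x | (c + k.+1%:R^-1)%:E <= g x].
have mP : measurable P.
  by apply: measurableI => //; rewrite -[X in measurable X]setTI; exact: emeasurable_fun_o_infty.
have mP' k : measurable (P' k).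
  by apply: measurableI => //; rewrite -[X in measurable X]setTI; exact: emeasurable_fun_c_infty.
have PX : P `<=` X by move=> x [].
have P'X k : P' k `<=` X by move=> x [].
have P'P k : P' k `<=` P.
  by move=> x [Xx /= h]; split => //=; apply: lt_le_trans h; rewrite lte_fin ltrDl.
have PU : P = \bigcup_k P' k.
  apply/seteqP; split => [x [Xx /=]|x [k _ /P'P]//].
  move: (g0 x); case gx : (g x) => [r| |]// _.
    rewrite lte_fin => /ltr_add_invr[k kr]; exists k => //; split => //=.
    by rewrite gx lee_fin ltW.
  by move=> _; exists 0%N => //; split => //=; rewrite gx leey.
have lo b B : (0 <= b)%R -> measurable B -> B `<=` X -> (forall x, B x -> b%:E <= g x) ->
    b%:E * mu B <= nu B.
  move=> b0 mB BX h; rewrite nuE// -integral_cst//; apply: ge0_le_integral => //.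
  exact: measurable_funTS.
have hi B : measurable B -> B `<=` X `\` P -> nu B <= c%:E * mu B.
  move=> mB BX; rewrite nuE//; last by move=> x /BX[].
  rewrite -integral_cst//; apply: ge0_le_integral => //.
  - exact: measurable_funTS.
  - move=> x /BX[Xx nP]; rewrite leNgt; apply/negP => h; apply: nP.
    by split.
have P0 : mu (P `\` f @^-1` P) = 0.
  have mfP : measurable (f @^-1` P) by rewrite -[X in measurable X]setTI; exact: mf.
  rewrite {1}PU setD_bigcupl bigcup_null// => k; first exact: measurableD.
  apply: (strict_excess_null mX mf fX mu_inv mA AX muA sweep nu_inv (c := c) (e := k.+1%:R^-1)) => //.
  - exact: ltW.
  - move=> B mB BP; apply: lo => //; [exact: ltW|exact: subset_trans BP _|].
    by move=> x /BP[_ /ltW].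
  - move=> B mB BP; apply: lo => //; first by rewrite addr_ge0// ltW.
      exact: subset_trans BP _.
    by move=> x /BP[].
have [P00|P00] := ergodic_almost_invariant mX mf fX mu_inv mA AX muA sweep mu_erg mP PX P0.
- left=> B mB BX.
  have nuBP : nu (B `&` P) = 0.
    apply: numu; [exact: measurableI|by move=> x [_ /PX]|].
    by apply: (@subset_measure0 _ _ _ mu _ P) => //; exact: measurableI.
  rewrite (measureDI nu mB mP) [X in _ + X]nuBP adde0.
  apply: le_trans (hi _ _ _) _; first exact: measurableD.
    by move=> x [/BX Xx nP].
  rewrite lee_wpmul2l ?lee_fin ?(ltW c0)//; apply: le_measure; rewrite ?inE//.
  exact: measurableD.
- right=> B mB BX.
  have muBP : mu (B `\` P) = 0.
    apply: (@subset_measure0 _ _ _ mu _ (X `\` P)) => //; [exact: measurableD..|].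
    by move=> x [/BX].
  rewrite [in leLHS](measureDI mu mB mP) [X in X + _]muBP add0e.
  apply: le_trans (lo _ _ _ _ _ _) _; [exact: ltW|exact: measurableI| | |].
  + by move=> x [/BX].
  + by move=> x [_ [_ /ltW]].
  + by apply: le_measure; rewrite ?inE//; exact: measurableI.
Qed.

Lemma invariant_measure_unique : nu X != 0 ->
  exists2 c : R, (0 < c)%R & forall B, measurable B -> B `<=` X -> nu B = c%:E * mu B.
Proof.
move=> nuX0; have [F XF /all_and2[mF Foo]] := nuX.
(* Almost every orbit visits [A], so a null [A] would make [X] null for [mu], hence for [nu]. *)
have muA0 : mu A != 0.
  apply/eqP => A0; move/eqP: nuX0; apply; apply: numu => //.
  apply: (null_of_lim_sup mX mf mA sweep (k := 0%N)) => //.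
  have mp n : measurable (X `&` (X `&` iter (n + 0) f @^-1` A)).
    by apply: measurableI => //; exact: preimage_iter_measurable.
  apply: (@lim_sup_set_bounded_sum _ _ _ _ _ 0) => // n.
  rewrite big1// => k _.
  apply: (@subset_measure0 _ _ _ mu _ (X `&` iter (k + 0) f @^-1` A)) => //.
    exact: preimage_iter_measurable.
  by apply: etrans A0; exact: (invariant_measure_iter mX mf fX mu_inv).
(* [A] has finite [mu] but perhaps infinite [nu]; cutting it by a piece of finite [nu] gives the
   reference set. *)
have [i Fi] : exists i, mu (F i `&` A) != 0.
  apply: contrapT => h; move/eqP: muA0; apply.
  have -> : A = \bigcup_i (F i `&` A).
    by rewrite -setI_bigcupl -XF setIidr.
  apply: bigcup_null => n; first exact: measurableI.
  by apply: contrapT => /eqP Fn; apply: h; exists n.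
apply: (@proportional_of_dichotomy X mu nu (F i `&` A)) => //.
- exact: measurableI.
- by move=> x [_ /AX].
- by apply: le_lt_trans muA; apply: le_measure; rewrite ?inE//; exact: measurableI.
- by apply: le_lt_trans (Foo i); apply: le_measure; rewrite ?inE//; exact: measurableI.
- exact: invariant_dichotomy.
Qed.

End uniqueness.

(** * Recurrence to [Gamma0] *)

Section recurrence.
Context (R : realType).
Local Notation S := (@triangle_map R).
Local Notation T := (@triangle R).
Local Notation mu := (@triangle_mu R).

(* [(1 - x) / y] decreases by one along each step taken in [Gamma1] *)
Lemma hits_Gamma0 (k : nat) (w : plane R) : T w ->
  (forall j, (iter j S w).2 != 0) -> 1 - w.1 < k%:R * w.2 ->
  exists j, Gamma0 (iter j S w).
Proof.
elim: k w => [|k IH] [x y] Tw nz; first by case: Tw => /= x1 _; rewrite mul0r; lra.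
move=> /= h; have [G|nG] := pselect (Gamma0 (x, y)); first by exists 0%N.
have G1 : Gamma1 (x, y) by [].
have SE := triangle_map_Gamma1 G1.
have [j jG] : exists j, Gamma0 (iter j S (S (x, y))).
  apply: IH; first exact: triangle_map_fun.
    by move=> j; rewrite -iterSr; exact: nz.
  move: G1; rewrite SE Gamma1E => -[/= xy [yx y0]].
  have y1 : 0 < 1 - y.
    rewrite lt_neqAle subr_ge0 eq_sym subr_eq0; apply/andP; split; last by lra.
    by apply/eqP => y1; rewrite -y1 in yx xy; lra.
  rewrite -(ltr_pM2r y1) mulrBl divfK ?gt_eqF// mul1r mulrA divfK ?gt_eqF//.
  by move: h; rewrite -natr1 mulrDl mul1r; lra.
by exists j.+1; rewrite iterSr.
Qed.

Lemma Gamma0_sweep :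
  mu (T `\` lim_sup_set (fun n => T `&` iter n S @^-1` @Gamma0 R)) = 0%E.
Proof.
have mT := @measurable_triangle R; have mS := @measurable_triangle_map R.
have ST := @triangle_map_fun R.
pose Z := T `&` [set z : plane R | z.2 = 0].
have mZ : measurable Z by apply: measurableI => //; exact: triangle_base_measurable.
have Z0 : mu Z = 0%E.
  have ZT : Z `<=` T by move=> z [].
  apply/(triangle_mu_eq0 mZ ZT); apply: (@subset_measure0 _ _ _ _ Z [set z : plane R | z.2 = 0]) => //.
  - exact: triangle_base_measurable.
  - by move=> z [].
  - exact: triangle_base_null.
have mL := measurable_lim_sup_pre mT mS (@measurable_Gamma0 R).
(* Orbits reaching the base [y = 0], where [hits_Gamma0] does not apply; by invariance they form a
   null set. *)
pose B := \bigcup_n (T `&` iter n S @^-1` Z).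
have mB n : measurable (T `&` iter n S @^-1` Z) by exact: preimage_iter_measurable.
apply: (@subset_measure0 _ _ _ mu _ B).
- exact: measurableD.
- exact: bigcup_measurable.
- move=> z [Tz nL]; apply: contrapT => nB; apply: nL => n _.
  have nz j : (iter (j + n) S z).2 != 0.
    apply/eqP => z0; apply: nB; exists (j + n)%N => //; split => //; split => //.
    exact: (iter_set_fun ST).
  have Tn : T (iter n S z) by exact: (iter_set_fun ST).
  have n20 : 0 < (iter n S z).2.
    by rewrite lt_neqAle eq_sym (nz 0%N); case: Tn => _ [].
  have [j jG] : exists j, Gamma0 (iter j S (iter n S z)).
    apply: (@hits_Gamma0 (Num.truncn (`|(1 - (iter n S z).1) / (iter n S z).2|)).+1) => //.
      by move=> j; rewrite -iterD; exact: nz.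
    rewrite -ltr_pdivrMr//; apply: le_lt_trans (ler_norm _) _.
    exact: truncnS_gt.
  exists (j + n)%N; first exact: leq_addl.
  by split => //=; rewrite iterD.
- apply: bigcup_null => // n.
  apply: etrans Z0.
  by apply: (invariant_measure_iter mT mS ST (@triangle_mu_invariant R)) => // z [].
Qed.

Lemma triangle_mu_sigma_finiteT : sigma_finite setT mu.
Proof.
have [F TF F_] := triangle_mu_sigma_finite R.
exists (fun n => if n is m.+1 then F m else ~` T).
  apply/seteqP; split => // z _; have [Tz|nT] := pselect (T z); last by exists 0%N.
  by move: Tz; rewrite TF => -[m _ Fz]; exists m.+1.
case=> [|m] //; split; first by apply: measurableC; exact: measurable_triangle.
by rewrite /triangle_mu setICl integral_set0.
Qed.

HB.instance Definition _ :=
  @Measure_isSigmaFinite.Build _ _ _ mu triangle_mu_sigma_finiteT.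

End recurrence.

(** * Cylinders *)

Section words.
Context (R : realType).
Local Notation S := (@triangle_map R).
Local Notation T := (@triangle R).

Definition step (b : bool) (p : R * R * R) : R * R * R :=
  if b then (p.1.2, p.2, p.1.1 + p.2) else (p.1.1, p.1.2, p.1.1 + p.2).

Definition steps (w : seq bool) (p : R * R * R) : R * R * R := foldr step p w.

(** The affine function with values [p.1.1], [p.1.2], [p.2] at the vertices [(0, 0)], [(1, 0)],
    [(1, 1)]. *)
Definition lin (p : R * R * R) (z : plane R) : R :=
  p.1.1 * (1 - z.1) + p.1.2 * (z.1 - z.2) + p.2 * z.2.

(** [S] is projective on each piece, so it carries affine functions to affine functions up to its
    denominator; [step b] is the induced map on coefficients. *)
Lemma lin_step b (p : R * R * R) (z : plane R) : Gamma b z ->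
  lin (step b p) (S z) = lin p z / (if b then z.1 else 1 - z.2).
Proof.
case: b z p => -[x y] [[p q] r]; rewrite /Gamma => G.
  rewrite triangle_map_Gamma0//; move: G => [/= x1 [yx xy]].
  by rewrite /lin/=; field; rewrite gt_eqF//; lra.
rewrite triangle_map_Gamma1//; move: G; rewrite Gamma1E => -[/= x1 [yx y0]].
rewrite /lin/=; have [y1|y1] := eqVneq (1 - y) 0; last by field.
by exfalso; lra.
Qed.

Lemma lin_branch b (p : R * R * R) (z : plane R) : triangle z ->
  lin p (branch b z) = lin (step b p) z / (1 + z.2).
Proof.
move=> [z1 [z21 z0]]; have : 1 + z.2 != 0 by rewrite gt_eqF//; lra.
by case: b; rewrite /lin /branch /= => ?; field.
Qed.

(** [lin (1, 1, 1)] is the constant 1, so by [lin_step] the value of [lin (den w)] at the end of an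
    orbit segment with digits [w] is the product of the reciprocals of the denominators met on the
    way. *)
Definition den (w : seq bool) := steps w (1, 1, 1).

Lemma den_ord w : 1 <= (den w).1.1 <= (den w).1.2 /\ (den w).1.2 <= (den w).2.
Proof.
elim: w => [|[] w [/andP[IH1 IH2] IH3]] /=; first by rewrite lexx.
  by rewrite /step/=; split; lra.
by rewrite /step/=; split; [apply/andP; split|]; lra.
Qed.

Lemma lin_gt0 (p : R * R * R) (z : plane R) : triangle z ->
  0 < p.1.1 -> 0 < p.1.2 -> 0 < p.2 -> 0 < lin p z.
Proof.
move=> [z1 [z21 z0]] p1 p2 p3; rewrite /lin.
have h1 : 0 <= p.1.1 * (1 - z.1) by rewrite mulr_ge0 ?subr_ge0// ltW.
have h2 : 0 <= p.1.2 * (z.1 - z.2) by rewrite mulr_ge0 ?subr_ge0// ltW.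
have h3 : 0 <= p.2 * z.2 by rewrite mulr_ge0// ltW.
have [y0|y0] := ltP 0 z.2.
  by have : 0 < p.2 * z.2 by [rewrite mulr_gt0]; lra.
have [x0|x0] := ltP 0 (z.1 - z.2).
  by have : 0 < p.1.2 * (z.1 - z.2) by [rewrite mulr_gt0]; lra.
have : 0 < p.1.1 * (1 - z.1) by rewrite mulr_gt0//; lra.
by lra.
Qed.

Definition wmass (w : seq bool) : R :=
  (2 * (den w).1.1 * (den w).1.2 * (den w).2)^-1.

Lemma wmass_gt0 w : 0 < wmass w.
Proof.
have [/andP[a ab] bc] := den_ord w.
by rewrite invr_gt0 !mulr_gt0//; lra.
Qed.

Lemma wmass_split w : wmass w = wmass (true :: w) + wmass (false :: w).
Proof.
have [/andP[a ab] bc] := den_ord w; rewrite /wmass /= -/(den w) /step /=.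
move: (den w) a ab bc => [[a b] c] /= a1 ab bc.
by field; rewrite !gt_eqF//; lra.
Qed.

(** Two digits [true] lead from [(A, B, C)] to [(C, A + C, A + B + C)], so the masses have ratio
    [A B / ((A + C) (A + B + C))]. Here [A + C <= 7 A] and [A + B + C <= 8 B], whence 56. *)
Lemma wmass_true_true w : (den w).2 <= 6 * (den w).1.1 ->
  56^-1 * wmass w <= wmass [:: true, true & w].
Proof.
have [/andP[a ab] bc] := den_ord w; rewrite /wmass /= -/(den w) /step /=.
move: (den w) a ab bc => [[p q] r] /= p1 pq qr rp.
have e1 : (p + r) * (q + (p + r)) <= (7 * p) * (8 * q) by apply: ler_pM; lra.
have : r * ((p + r) * (q + (p + r))) <= r * ((7 * p) * (8 * q)).
  by apply: ler_wpM2l => //; lra.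
rewrite -invfM lef_pV2 ?posrE; first by lra.
- by rewrite !mulr_gt0//; lra.
- by rewrite !mulr_gt0//; lra.
Qed.

Lemma den_nseq k w :
  den (nseq k false ++ w) = ((den w).1.1, (den w).1.2, (den w).2 + k%:R * (den w).1.1).
Proof.
elim: k => [|k IH] /=; first by rewrite mul0r addr0; case: (den w) => [[]].
by rewrite -/(den _) IH /step /= -natr1; congr (_, _, _); ring.
Qed.

(** * From a gain at balanced words to a gain at all words *)

Section reach.
Variables (Q : seq bool -> Prop) (g : seq bool -> R) (s : R).
Hypotheses (Qcons : forall b w, Q w -> Q (b :: w)) (s0 : 0 <= s).
Hypothesis g_split : forall w, Q w -> g w = g (true :: w) + g (false :: w).
Hypothesis g_le : forall w, Q w -> g w <= s * wmass w.

(** A run of [K] digits [false] turns [C] into [C + K A], so for the least [K] with [C <= K A] the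
    words that begin with such a run carry at most half of the mass and get the trivial bound. The
    rest splits by the length [k < K] of the run before the first [true]; there [k A < C] and the
    gain [eta] applies. *)
Lemma excursion_le (eta : R) w : 0 <= eta -> Q w ->
  (forall k, k%:R * (den w).1.1 < (den w).2 ->
    g (true :: nseq k false ++ w) <= (1 - eta) * s * wmass (true :: nseq k false ++ w)) ->
  g w <= (1 - eta / 2) * s * wmass w.
Proof.
move=> eta0 Qw H.
have Qk k : Q (nseq k false ++ w) by elim: k => // k IH; exact: Qcons.
have [/andP[a ab] bc] := den_ord w.
have a0 : 0 < (den w).1.1 by lra.
have tele K : (forall k, (k < K)%N -> k%:R * (den w).1.1 < (den w).2) ->
    g w <= (1 - eta) * s * (wmass w - wmass (nseq K false ++ w)) +
           s * wmass (nseq K false ++ w).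
  move=> HK; suff : g w <= (1 - eta) * s * (wmass w - wmass (nseq K false ++ w)) +
      g (nseq K false ++ w) by have := g_le (Qk K); lra.
  elim: K HK => [|K IH] HK; first by rewrite subrr mulr0 add0r.
  apply: le_trans (IH _) _ => [k kK|]; first by apply: HK; exact: leqW.
  have := H K (HK K (ltnSn K)); rewrite (g_split (Qk K)) (wmass_split (nseq K false ++ w)) /=.
  set u1 := wmass _; set u2 := wmass (_ :: _); set u3 := g _; set u4 := g _.
  by lra.
have [K0 HK0] : exists K, (den w).2 <= K%:R * (den w).1.1.
  exists (Num.truncn (`|(den w).2|)).+1.
  apply: le_trans (ler_norm _) _; apply: le_trans (ltW (truncnS_gt _)) _.
  by rewrite ler_peMr//; lra.
have exK : exists K, (den w).2 <= K%:R * (den w).1.1 by exists K0.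
case: (ex_minnP exK) => K HK Kmin.
have := tele K; have KH k : (k < K)%N -> k%:R * (den w).1.1 < (den w).2.
  by move=> kK; rewrite ltNge; apply/negP => /Kmin; rewrite leqNgt kK.
move=> /(_ KH).
have : wmass (nseq K false ++ w) <= wmass w / 2.
  rewrite /wmass den_nseq /= -invfM lef_pV2 ?posrE; last 2 first.
  - by rewrite !mulr_gt0//; lra.
  - by rewrite !mulr_gt0//; lra.
  have : 0 < 2 * (den w).1.1 * (den w).1.2 by rewrite !mulr_gt0//; lra.
  by move: (2 * _ * _) => u u0; nra.
move: (wmass_gt0 w) (wmass (nseq K false ++ w)) => W0 u uW gw.
apply: (le_trans gw).
have : 0 <= eta * s by exact: mulr_ge0.
by move=> es0; nra.
Qed.

(* the two excursions make the three weights comparable: the first one gives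
   [C <= 2 B] and the second one [C <= 6 A] *)
Lemma reach_le (eta : R) : 0 <= eta ->
  (forall w, Q w -> (den w).2 <= 6 * (den w).1.1 -> g w <= (1 - eta) * s * wmass w) ->
  forall w, Q w -> g w <= (1 - eta / 4) * s * wmass w.
Proof.
move=> eta0 H.
have Qk w k : Q w -> Q (true :: nseq k false ++ w).
  by move=> Qw; apply: Qcons; elim: k => // k IH; exact: Qcons.
have H1 w : Q w -> (den w).2 <= 2 * (den w).1.2 -> g w <= (1 - eta / 2) * s * wmass w.
  move=> Qw cb; apply: excursion_le => // k kc; apply: H; first exact: Qk.
  have [/andP[a ab] bc] := den_ord w.
  by rewrite /= -/(den _) den_nseq /step /=; lra.
move=> w Qw; have -> : eta / 4 = (eta / 2) / 2 by field.
apply: excursion_le => // [|k kc]; first by rewrite divr_ge0.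
apply: H1; first exact: Qk.
have [/andP[a ab] bc] := den_ord w.
by rewrite /= -/(den _) den_nseq /step /=; have : 0 <= k%:R * (den w).1.1 by [rewrite mulr_ge0//; lra]; lra.
Qed.

End reach.

(** The latest digit comes first: one more iterate is a cons, and the digits of a shorter orbit
    segment form a suffix. *)
Fixpoint digits n (z : plane R) : seq bool :=
  if n is m.+1 then (iter m S z \in @Gamma0 R) :: digits m z else [::].

Definition cylinder (w : seq bool) : set (plane R) :=
  T `&` [set z | digits (size w) z = w].

Lemma cylinder_cons b w :
  cylinder (b :: w) = cylinder w `&` iter (size w) S @^-1` Gamma b.
Proof.
apply/seteqP; split => z /=.
  move=> [Tz [bE wE]]; split; first by split.
  have Tn : T (iter (size w) S z) by exact: (iter_set_fun (@triangle_map_fun R)).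
  rewrite -bE /Gamma; case: ifPn; rewrite ?inE// => /negP h; split => // h'.
  by apply: h; rewrite inE.
move=> [[Tz wE]] G; split => //=; congr cons => //.
by move: G; rewrite /Gamma; case: (b) => [/mem_set//|[_ h]]; exact: memNset.
Qed.

Lemma measurable_cylinder w : measurable (cylinder w).
Proof.
elim: w => [|b w IH].
  by rewrite (_ : cylinder _ = T) ?setIT//; [exact: measurable_triangle|apply/seteqP; split => // z []].
rewrite cylinder_cons (_ : _ `&` _ = cylinder w `&` (T `&` iter (size w) S @^-1` Gamma b)).
  apply: measurableI => //; apply: preimage_iter_measurable; last exact: measurable_Gamma.
  - exact: measurable_triangle.
  - exact: measurable_triangle_map.
by rewrite setIA; congr (_ `&` _); rewrite setIidl// => z [].
Qed.

(* reading the linear forms at both ends of an orbit segment shows that they are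
   multiplied by a common factor *)
Lemma lin_cylinder (p : R * R * R) w z : cylinder w z ->
  lin (steps w p) (iter (size w) S z) =
  lin p z * lin (den w) (iter (size w) S z).
Proof.
elim: w => [|b w IH] /=.
  by move=> _; rewrite {3}/lin/=; ring.
rewrite cylinder_cons => -[zw G]; rewrite lin_step// IH// -/(den (b :: w)).
by rewrite lin_step// mulrA.
Qed.

End words.

(** * Lebesgue measure of cylinders *)

Section cylinder_measure.
Context (R : realType).
Local Notation L := (@lebesgue_measure R).
Local Notation MR := (measurableTypeR R).
Local Notation L2 := (L \x L)%E.
Local Notation S := (@triangle_map R).
Local Notation T := (@triangle R).

Lemma measurable_lin (p : R * R * R) : measurable_fun [set: plane R] (lin p).
Proof.
have m1 : measurable_fun [set: plane R] (fun z => 1 - z.1 : R) by exact: measurable_funB.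
have m2 : measurable_fun [set: plane R] (fun z => z.1 - z.2 : R) by exact: measurable_funB.
have mc (c : R) (h : plane R -> R) : measurable_fun setT h -> measurable_fun setT (fun z => c * h z).
  by move=> mh; exact: measurable_funM.
by apply: measurable_funD; [apply: measurable_funD|]; apply: mc.
Qed.

Lemma measurable_lin_cube (p : R * R * R) :
  measurable_fun [set: plane R] (fun z => `|lin p z ^- 3|%:E).
Proof.
apply/measurable_EFinP; apply: (measurableT_comp (@normr_measurable R setT)).
apply: (measurableT_comp (@measurable_inv R)); apply: measurable_funX.
exact: measurable_lin.
Qed.

Lemma integral_lin_section (a b c y : R) : 0 < a -> 0 < b -> 0 < c -> 0 <= y <= 1 ->
  (\int[L]_(x in `[y, 1%R]) (((a * (1 - x) + b * (x - y) + c * y) ^- 3)%:E) =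
  ((1 - y) * ((a * (1 - y) + c * y) + (b * (1 - y) + c * y)) *
    (2 * (a * (1 - y) + c * y) ^+ 2 * (b * (1 - y) + c * y) ^+ 2)^-1)%:E)%E.
Proof.
move=> a0 b0 c0 /andP[y0 y1].
pose D0 := a * (1 - y) + c * y.
have D0gt : 0 < D0.
  rewrite /D0; have : 0 <= a * (1 - y) by rewrite mulr_ge0//; lra.
  have : 0 <= c * y by rewrite mulr_ge0//; lra.
  have [y0'|y0'] := ltP 0 y; first by have : 0 < c * y by [rewrite mulr_gt0]; lra.
  by have : 0 < a * (1 - y) by [rewrite mulr_gt0//; lra]; lra.
have Dgt x : x \in `[y, 1] -> 0 < a * (1 - x) + b * (x - y) + c * y.
  rewrite in_itv/= => /andP[yx x1].
  have Txy : @triangle R (x, y) by [].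
  exact: (@lin_gt0 R (a, b, c) (x, y)).
(* The usual primitive divides by [a - b]. Subtracting its value at [x = y] cancels this factor,
   because the form falls by [(a - b) * (x - y)] from its value [D0]; so [a = b] is no exception. *)
pose F (x : R) : R := (2 * D0 ^+ 2)^-1 * ((x - y) * (D0 + (a * (1 - x) + b * (x - y) + c * y))) *
  ((a * (1 - x) + b * (x - y) + c * y)^-1) ^+ 2.
have dF (x : R) : x \in `[y, 1] -> is_derive x (1 : R) F ((a * (1 - x) + b * (x - y) + c * y) ^- 3).
  move=> /Dgt Dx; have Dx0 : a * (1 - x) + b * (x - y) + c * y != 0 by rewrite gt_eqF.
  rewrite /F; apply: is_derive_eq; rewrite /GRing.scale/=.
  move: D0gt Dx0 => /lt0r_neq0; rewrite /D0 => h1 h2; field.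
  by rewrite h1 h2.
have df (x : R) : x \in `[y, 1] ->
    derivable (fun x : R => (a * (1 - x) + b * (x - y) + c * y) ^- 3 : R) x 1.
  move=> xI; have Dx0 : (a * (1 - x) + b * (x - y) + c * y) ^+ 3 != 0.
    by rewrite expf_neq0// gt_eqF// Dgt.
  exact: ex_derive.
rewrite (continuous_FTC2_is_derive y1 dF df).
have D1gt : 0 < b * (1 - y) + c * y.
  by have := Dgt 1; rewrite in_itv/= y1 lexx subrr mulr0 add0r; apply.
have -> : F y = 0 by rewrite /F subrr mul0r mulr0 mul0r.
rewrite /F subr0 -/D0 (_ : a * (1 - 1) + b * (1 - y) + c * y = b * (1 - y) + c * y); last by ring.
move: D0gt D1gt; clear dF df F; move: D0 (b * (1 - y) + c * y) => u v u0 v0.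
by congr (_%:E); field; rewrite !gt_eqF.
Qed.

Lemma integral_lin_sections (a b c : R) : 0 < a -> 0 < b -> 0 < c ->
  (\int[L]_(y in `[0%R, 1%R])
    ((1 - y) * ((a * (1 - y) + c * y) + (b * (1 - y) + c * y)) *
    (2 * (a * (1 - y) + c * y) ^+ 2 * (b * (1 - y) + c * y) ^+ 2)^-1)%:E =
  ((2 * a * b * c)^-1)%:E)%E.
Proof.
move=> a0 b0 c0.
have Dgt d y : 0 < d -> y \in `[0, 1] -> 0 < d * (1 - y) + c * y.
  move=> d0; rewrite in_itv/= => /andP[y0 y1].
  have : 0 <= d * (1 - y) by rewrite mulr_ge0//; lra.
  have : 0 <= c * y by rewrite mulr_ge0//; lra.
  have [y0'|y0'] := ltP 0 y; first by have : 0 < c * y by [rewrite mulr_gt0]; lra.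
  by have : 0 < d * (1 - y) by [rewrite mulr_gt0//; lra]; lra.
(* [- F y] is the area over the product of the vertex values for the part of the triangle above
   height [y], with vertices [(y, y)], [(1, y)], [(1, 1)]. *)
pose F (y : R) : R := - (2 * c)^-1 * (1 - y) ^+ 2 *
  (a * (1 - y) + c * y)^-1 * (b * (1 - y) + c * y)^-1.
pose f (y : R) : R := (1 - y) * ((a * (1 - y) + c * y) + (b * (1 - y) + c * y)) *
  (2 * (a * (1 - y) + c * y) ^+ 2 * (b * (1 - y) + c * y) ^+ 2)^-1.
have dF (y : R) : y \in `[0, 1] -> is_derive y (1 : R) F (f y).
  move=> yI; have h1 : a * (1 - y) + c * y != 0 by rewrite gt_eqF// Dgt.
  have h2 : b * (1 - y) + c * y != 0 by rewrite gt_eqF// Dgt.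
  have h3 : c != 0 by rewrite gt_eqF.
  rewrite /F /f; apply: is_derive_eq; rewrite /GRing.scale/=; field.
  by rewrite h1 h2 h3.
have df (y : R) : y \in `[0, 1] -> derivable f y (1 : R).
  move=> yI.
  have h1 : 2 * (a * (1 - y) + c * y) ^+ 2 * (b * (1 - y) + c * y) ^+ 2 != 0.
    by rewrite !mulf_neq0 ?expf_neq0// gt_eqF// Dgt.
  rewrite /f; exact: ex_derive.
rewrite (continuous_FTC2_is_derive ler01 dF df).
congr (_%:E); rewrite /F !subrr expr0n/= !mulr0 !mul0r !subr0 !mulr1 addr0.
by field; rewrite !gt_eqF.
Qed.

Lemma integral_lin (p : R * R * R) : 0 < p.1.1 -> 0 < p.1.2 -> 0 < p.2 ->
  (\int[L2]_(z in T) `|lin p z ^- 3|%:E = ((2 * p.1.1 * p.1.2 * p.2)^-1)%:E)%E.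
Proof.
move=> a0 b0 c0; rewrite -integral_lin_sections//.
have mT : measurable T by exact: measurable_triangle.
pose F z := (`|lin p z ^- 3|%:E * (\1_T z)%:E)%E.
have mF : measurable_fun setT F.
  apply: emeasurable_funM; first exact: measurable_lin_cube.
  by apply/measurable_EFinP; exact: measurable_indic.
have F0 z : (0 <= F z)%E by rewrite mule_ge0// lee_fin.
transitivity (\int[L2]_z F z)%E.
  by rewrite integral_mkcond; apply: eq_integral => z _; rewrite epatch_indic.
rewrite (@fubini_tonelli2 _ _ MR MR R L L F mF F0).
rewrite [RHS]integral_mkcond; apply: eq_integral => y _; rewrite patchE /fubini_G.
case: ifPn => yI; last first.
  apply: integral0_eq => x _; rewrite /F indicE memNset ?mule0// => -[/= x1 [yx y0]].
  by move/negP: yI; apply; rewrite inE/= in_itv/= y0 (le_trans yx).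
have y01 : 0 <= y <= 1 by move: yI; rewrite inE/= in_itv.
rewrite -integral_lin_section// [RHS]integral_mkcond; apply: eq_integral => x _.
rewrite patchE; case: ifPn => xI.
  move: xI; rewrite inE/= in_itv/= => /andP[yx x1].
  have Txy : T (x, y) by do !split => //; case/andP: y01.
  by rewrite /F indicE mem_set// mule1 ger0_norm// invr_ge0 exprn_ge0// ltW// lin_gt0.
rewrite /F indicE memNset ?mule0// => -[/= x1 [yx y0]].
by move/negP: xI; apply; rewrite inE/= in_itv/= yx.
Qed.

(** [lin (den w) ^- 3] is the Jacobian of the inverse branch of the word. By [lin_branch],
    [lin (den w)] at [branch b z] is [lin (den (b :: w)) z / (1 + z.2)], and the cube of this
    denominator cancels the Jacobian of the new digit. *)
Lemma cylinder_preimage_measure w (E : set (plane R)) : measurable E -> E `<=` T ->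
  (L2 (cylinder w `&` iter (size w) S @^-1` E) =
   \int[L2]_(z in E) `|lin (den R w) z ^- 3|%:E)%E.
Proof.
elim: w E => [|b w IH] E mE ET /=.
  rewrite (_ : _ `&` _ = E); last by apply/seteqP; split => z /=; [case|move=> Ez; split => //; split => //; exact: ET].
  rewrite (eq_integral (cst 1%E)) ?integral_cst ?mul1e// => z _.
  by congr (_%:E); rewrite /lin/= (_ : _ + _ = 1) ?expr1n ?invr1 ?normr1//; ring.
rewrite cylinder_cons.
rewrite (_ : _ `&` _ = cylinder w `&` iter (size w) S @^-1` (Gamma b `&` S @^-1` E)); last first.
  by apply/seteqP; split => z /=; tauto.
rewrite IH; last 2 first.
- by apply: measurableI; [exact: measurable_Gamma|exact: preimage_measurable].
- by move=> z [/Gamma_sub_triangle].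
rewrite triangle_map_change_of_variables//; last exact: measurable_lin_cube.
apply: eq_integral => z; rewrite inE => /ET Tz.
have z1 : 0 < 1 + z.2 by case: Tz => _ [_]; lra.
rewrite lin_branch// -EFinM; congr (_%:E).
rewrite expr_div_n invf_div normrM (ger0_norm (x := (1 + z.2) ^+ 3)) ?exprn_ge0 ?ltW//.
by rewrite mulrAC divff ?mul1r// expf_neq0// gt_eqF.
Qed.

Lemma cylinder_measure w : (L2 (cylinder w) = (wmass R w)%:E)%E.
Proof.
have [/andP[a ab] bc] := den_ord R w.
rewrite -integral_lin; [|lra..].
rewrite -cylinder_preimage_measure//; last exact: measurable_triangle.
rewrite (setIidl (B := iter (size w) S @^-1` T))// => z [Tz _].
exact: (iter_set_fun (@triangle_map_fun R)).
Qed.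

End cylinder_measure.

(** * Ergodicity *)

Section approximation.
Context d (T : measurableType d) (R : realType) (mu : {measure set T -> \bar R}).
Hypothesis muT : (mu setT < +oo)%E.
Variable G : set (set T).
Hypotheses (mG : G `<=` measurable) (G0 : G set0) (GC : setC_closed G) (GU : setU_closed G).

Definition approximable (F : set T) := measurable F /\
  forall e : R, 0 < e -> exists2 B, G B & (mu ((F `\` B) `|` (B `\` F)) <= e%:E)%E.

Let mD (A B : set T) : measurable A -> measurable B -> measurable ((A `\` B) `|` (B `\` A)).
Proof. by move=> mA mB; apply: measurableU; exact: measurableD. Qed.

Lemma approximableU F1 F2 : approximable F1 -> approximable F2 -> approximable (F1 `|` F2).
Proof.
move=> [mF1 H1] [mF2 H2]; split; first exact: measurableU.
move=> e e0; have e20 : 0 < e / 2 by rewrite divr_gt0.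
have [B1 GB1 h1] := H1 _ e20; have [B2 GB2 h2] := H2 _ e20.
have mB1 := mG GB1; have mB2 := mG GB2.
exists (B1 `|` B2); first exact: GU.
apply: (@le_trans _ _ (mu (((F1 `\` B1) `|` (B1 `\` F1)) `|` ((F2 `\` B2) `|` (B2 `\` F2))))).
  apply: le_measure; rewrite ?inE.
  - by apply: mD; exact: measurableU.
  - by apply: measurableU; exact: mD.
  - by move=> z /=; tauto.
apply: le_trans (measureU2 _ _ _) _; [exact: mD|exact: mD|].
by rewrite (splitr e) EFinD leeD.
Qed.

(** Half-planes are unions of cylinders only up to a null set; this closes the gap. *)
Lemma approximable_sub F F' : approximable F -> measurable F' -> F `<=` F' ->
  mu (F' `\` F) = 0%E -> approximable F'.
Proof.
move=> [mF H] mF' FF' F'0; split => // e e0; have [B GB h] := H _ e0.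
have mB := mG GB; exists B => //; apply: le_trans h.
apply: (@le_trans _ _ (mu ((F' `\` F) `|` ((F `\` B) `|` (B `\` F))))).
  apply: le_measure; rewrite ?inE.
  - exact: mD.
  - by apply: measurableU; [exact: measurableD|exact: mD].
  - by move=> z /=; have := @FF' z; have := EM (F z); tauto.
apply: le_trans (measureU2 _ _ _) _; [exact: measurableD|exact: mD|].
by rewrite [X in (X + _)%E]F'0 add0e.
Qed.

Lemma approximable_sigma_algebra : sigma_algebra setT approximable.
Proof.
have A0 : approximable set0.
  split => // e e0; exists set0 => //.
  by rewrite setD0 setU0 measure0 lee_fin ltW.
split => //.
  move=> A [mA H]; rewrite setTD; split; first exact: measurableC.
  move=> e e0; have [B GB h] := H _ e0; exists (~` B); first exact: GC.
  rewrite (_ : _ `|` _ = (A `\` B) `|` (B `\` A))//.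
  apply/seteqP; split => z /=; have := EM (A z); have := EM (B z); tauto.
move=> F H; pose U n := \big[setU/set0]_(k < n) F k.
have mF n : measurable (F n) by case: (H n).
have HU n : approximable (U n).
  by elim: n => [|n IH]; rewrite /U ?big_ord0// big_ord_recr; exact: approximableU.
have mU n : measurable (U n) by case: (HU n).
have mUF : measurable (\bigcup_k F k) by exact: bigcup_measurable.
have UF n : U n `<=` \bigcup_k F k.
  by rewrite /U -bigcup_mkord => z [k _ Fk]; exists k.
split => // e e0; have e20 : 0 < e / 2 by rewrite divr_gt0.
(* As [mu] is finite, continuity from above makes the tails vanish, which reduces the countable
   union to a finite one. *)
have [N HN] : exists N, (mu ((\bigcup_k F k) `\` U N) <= (e / 2)%:E)%E.
  apply: contrapT => h.
  have cap0 : \bigcap_n ((\bigcup_k F k) `\` U n) = set0.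
    rewrite -subset0 => z zI; have [[k _ Fk] _] := zI 0%N I.
    have [_] := zI k.+1 I; apply.
    by rewrite /U -bigcup_mkord; exists k => //=.
  have cvg0 : (mu ((\bigcup_k F k) `\` U n) @[n --> \oo] --> 0)%E.
    rewrite -(@measure0 _ _ _ mu) -cap0; apply: nonincreasing_cvg_mu.
    - by apply: le_lt_trans muT; apply: le_measure; rewrite ?inE//; exact: measurableD.
    - by move=> n; exact: measurableD.
    - by rewrite cap0.
    - move=> n p np; apply/subsetPset => z [Fz nU]; split => // Un; apply: nU.
      move: Un; rewrite /U -!bigcup_mkord => -[k /= kn Fk]; exists k => //=.
      exact: leq_trans kn np.
  have : ((e / 2)%:E <= 0)%E.
    rewrite -(cvg_lim _ cvg0)//; apply: lime_ge; first by apply/cvg_ex; exists 0%E.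
    apply: nearW => n; rewrite leNgt; apply/negP => hn; apply: h.
    by exists n; exact: ltW.
  by rewrite lee_fin leNgt e20.
have [_ /(_ _ e20)[B GB h]] := HU N; have mB := mG GB.
exists B => //.
apply: (@le_trans _ _ (mu (((\bigcup_k F k) `\` U N) `|` ((U N `\` B) `|` (B `\` U N))))).
  apply: le_measure; rewrite ?inE.
  - exact: mD.
  - by apply: measurableU; [exact: measurableD|exact: mD].
  - by move=> z; have := @UF N z; move: (\bigcup_k F k) => V /=; have := EM (U N z); tauto.
apply: le_trans (measureU2 _ _ _) _; [exact: measurableD|exact: mD|].
by rewrite (splitr e) EFinD leeD.
Qed.

End approximation.

(** * Shrinking of cylinders *)

Section narrow.
Context (R : realType).
Local Notation S := (@triangle_map R).
Local Notation T := (@triangle R).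

(** Bounds on the ratios of entries, multiplied out: in linear form they survive adding columns. *)
Definition between (lo r : R) (p q : R * R * R) :=
  [/\ lo * q.1.1 <= p.1.1 <= (lo + r) * q.1.1,
      lo * q.1.2 <= p.1.2 <= (lo + r) * q.1.2 &
      lo * q.2 <= p.2 <= (lo + r) * q.2].

(* the columns of [steps w] are the homogeneous coordinates of the vertices of the
   cylinder of [w]: their abscissas, or ordinates, range over an interval of length [r] *)
Definition narrow (r : R) (w : seq bool) :=
  (exists lo, between lo r (steps w (0, 1, 1)) (den R w)) /\
  (exists lo, between lo r (steps w (0, 0, 1)) (den R w)).

Lemma between_step b lo r p q : between lo r p q -> between lo r (step b p) (step b q).
Proof.
by case: b => -[/andP[h1 h2] /andP[h3 h4] /andP[h5 h6]]; split => /=;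
  apply/andP; split; lra.
Qed.

Lemma narrow_cons r b w : narrow r w -> narrow r (b :: w).
Proof. by move=> [[l h] [l' h']]; split; [exists l|exists l']; exact: between_step. Qed.

(** After two digits [true] every column contains the last column [C] with weight at least 1/3,
    because [A + C <= 2 C] and [A + B + C <= 3 C]. All ratios are thus drawn by a third towards
    [lo + t], the ratio of the last column. *)
Lemma between_contract lo r p q : 0 < q.1.1 -> q.1.1 <= q.1.2 -> q.1.2 <= q.2 ->
  between lo r p q ->
  exists lo', between lo' (r * (2 / 3)) (step true (step true p)) (step true (step true q)).
Proof.
case: p q => [[p1 p2] p3] [[a b] c] /= a0 ab bc [/= /andP[h1 h2] /andP[h3 h4] /andP[h5 h6]].
have c0 : 0 < c by lra.
pose t := p3 / c - lo; have p3E : p3 = (lo + t) * c.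
  by rewrite /t addrC subrK divfK// gt_eqF.
have t0 : 0 <= t by rewrite -(ler_pM2r c0); move: h5; rewrite p3E; lra.
have tr : 0 <= r - t by rewrite -(ler_pM2r c0); move: h6; rewrite p3E; lra.
have k1 : 0 <= t * (2 * c - a) by rewrite mulr_ge0//; lra.
have k2 : 0 <= t * (2 * c - (a + b)) by rewrite mulr_ge0//; lra.
have k3 : 0 <= (r - t) * (2 * c - a) by rewrite mulr_ge0//; lra.
have k4 : 0 <= (r - t) * (2 * c - (a + b)) by rewrite mulr_ge0//; lra.
have k5 : 0 <= t * c by rewrite mulr_ge0//; lra.
have k6 : 0 <= (r - t) * c by rewrite mulr_ge0//; lra.
exists (lo + t / 3); clearbody t; subst p3; rewrite /step /=.
by split => /=; apply/andP; split; lra.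
Qed.

Lemma narrow_contract r w : narrow r w -> narrow (r * (2 / 3)) [:: true, true & w].
Proof.
have [/andP[a ab] bc] := den_ord R w.
have a0 : 0 < (den R w).1.1 by lra.
by move=> [[l h] [l' h']]; split; apply: between_contract; eauto.
Qed.

Lemma narrow_nil : narrow 1 [::].
Proof. by split; exists 0; split => /=; apply/andP; split; lra. Qed.

(** By [lin_cylinder], [lin p z] is the quotient of [lin (steps w p)] by [lin (den w)] at the end of
    the orbit segment, that is, an average of the column ratios with nonnegative weights. *)
Lemma between_cylinder lo r p w z : cylinder w z -> between lo r (steps w p) (den R w) ->
  lo <= lin p z <= lo + r.
Proof.
move=> zw [/andP[h1 h2] /andP[h3 h4] /andP[h5 h6]].
have Tn : T (iter (size w) S z).
  by apply: (iter_set_fun (@triangle_map_fun R)); case: zw.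
have [/andP[a ab] bc] := den_ord R w.
have D0 : 0 < lin (den R w) (iter (size w) S z) by apply: lin_gt0 => //; lra.
have E := lin_cylinder p zw.
move: Tn E D0 => [z1 [z21 z0]].
move: (iter _ _ _) z1 z21 z0 => [x y] /= z1 z21 z0 E D0.
have x1 : 0 <= 1 - x by lra.
have xy : 0 <= x - y by lra.
apply/andP; split; rewrite -(ler_pM2r D0) -E /lin/=.
  by have := ler_wpM2r x1 h1; have := ler_wpM2r xy h3; have := ler_wpM2r z0 h5; lra.
by have := ler_wpM2r x1 h2; have := ler_wpM2r xy h4; have := ler_wpM2r z0 h6; lra.
Qed.

Lemma narrow_dist r w (z z' : plane R) : narrow r w -> cylinder w z -> cylinder w z' ->
  `|z.1 - z'.1| <= r /\ `|z.2 - z'.2| <= r.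
Proof.
have e1 (t : plane R) : lin (0, 1, 1) t = t.1 by rewrite /lin/=; ring.
have e2 (t : plane R) : lin (0, 0, 1) t = t.2 by rewrite /lin/=; ring.
move=> [[l h] [l' h']] zw zw'.
have := between_cylinder zw h; have := between_cylinder zw h'.
have := between_cylinder zw' h; have := between_cylinder zw' h'.
rewrite !e1 !e2 => /andP[? ?] /andP[? ?] /andP[? ?] /andP[? ?].
by split; rewrite ler_norml; apply/andP; split; lra.
Qed.

End narrow.

(** * Cylinders generate up to null sets; ergodicity *)

Section ergodicity.
Context (R : realType).
Local Notation S := (@triangle_map R).
Local Notation T := (@triangle R).
Local Notation m := (@lebesgue_triangle R).
Local Notation L2 := (@lebesgue_measure R \x @lebesgue_measure R)%E.
Local Notation cyl w := (@cylinder R w).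
Local Notation wmass := (@wmass R).
Local Notation den := (@den R).

Let mT : measurable T. Proof. exact: measurable_triangle. Qed.

Lemma lebesgue_triangleE (A : set (plane R)) : A `<=` T -> m A = L2 A.
Proof. by move=> AT; rewrite /= /mrestr setIidl. Qed.

Lemma lebesgue_triangleI (A : set (plane R)) : m (A `&` T) = m A.
Proof. by transitivity (L2 (A `&` T `&` T)); [|rewrite -setIA setIid]. Qed.

Lemma lebesgue_triangle_setT : (m setT < +oo)%E.
Proof. by rewrite /= /mrestr setTI; exact: lebesgue_triangle_lty. Qed.

Lemma lebesgue_triangle_cylinder w : m (cyl w) = (wmass w)%:E.
Proof. by rewrite lebesgue_triangleE ?cylinder_measure// => z []. Qed.

Definition cmass (Z : set (plane R)) w : R := fine (m (Z `&` cyl w)).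

Lemma cmassE Z w : measurable Z -> m (Z `&` cyl w) = (cmass Z w)%:E.
Proof.
move=> mZ; rewrite fineK// ge0_fin_numE//; apply: le_lt_trans lebesgue_triangle_setT.
apply: le_measure; rewrite ?inE//; apply: measurableI => //; exact: measurable_cylinder.
Qed.

Lemma cmass_ge0 Z w : 0 <= cmass Z w.
Proof. exact: fine_ge0. Qed.

Lemma cmass_le Z w : measurable Z -> cmass Z w <= wmass w.
Proof.
move=> mZ; rewrite -lee_fin -cmassE// -lebesgue_triangle_cylinder.
apply: le_measure; rewrite ?inE//; last exact: measurable_cylinder.
by apply: measurableI => //; exact: measurable_cylinder.
Qed.

Lemma cylinder_split w : cyl w = cyl (true :: w) `|` cyl (false :: w).
Proof.
rewrite !cylinder_cons -setIUr setIidl// => z [Tz _].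
have Tn : T (iter (size w) S z) by exact: (iter_set_fun (@triangle_map_fun R)).
by have [G|G] := pselect (Gamma0 (iter (size w) S z)); [left|right].
Qed.

Lemma cylinder_disjoint w : cyl (true :: w) `&` cyl (false :: w) = set0.
Proof. by rewrite -subset0 !cylinder_cons => z [[_ G] [_ [_ nG]]]. Qed.

Lemma measure_cylinder_split (Z : set (plane R)) w : measurable Z ->
  m (Z `&` cyl w) = (m (Z `&` cyl (true :: w)) + m (Z `&` cyl (false :: w)))%E.
Proof.
move=> mZ; rewrite {1}cylinder_split setIUr measureU//.
- by apply: measurableI => //; exact: measurable_cylinder.
- by apply: measurableI => //; exact: measurable_cylinder.
- by rewrite setIACA cylinder_disjoint setI0.
Qed.

Lemma cmass_split Z w : measurable Z ->
  cmass Z w = cmass Z (true :: w) + cmass Z (false :: w).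
Proof.
move=> mZ; apply: EFin_inj; rewrite EFinD -!cmassE//.
exact: measure_cylinder_split.
Qed.

Section words_union.
Variable P : seq bool -> Prop.

(** Words are enumerated by [unpickle], so that a union over any set of words is a countable one. *)
Let F n : set (plane R) :=
  if unpickle n is Some w then if `[< P w >] then cyl w else set0 else set0.

Definition cylinders := [set z : plane R | exists2 w, P w & cyl w z].

Lemma cylindersE : cylinders = \bigcup_n F n.
Proof.
apply/seteqP; split => [z [w Pw wz]|z [n _]].
  by exists (pickle w) => //; rewrite /F pickleK asboolT.
rewrite /F; case: unpickle => [w|] //; case: ifPn => [/asboolP Pw wz|] //.
by exists w.
Qed.

Lemma measurable_cylinders : measurable cylinders.
Proof.
rewrite cylindersE; apply: bigcup_measurable => n _; rewrite /F.
by case: unpickle => [w|] //; case: ifP => // _; exact: measurable_cylinder.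
Qed.

Lemma cylinders_null (Z : set (plane R)) : measurable Z ->
  (forall w, P w -> m (Z `&` cyl w) = 0%E) -> m (Z `&` cylinders) = 0%E.
Proof.
move=> mZ H; rewrite cylindersE setI_bigcupr; apply: bigcup_null => n.
  apply: measurableI => //; rewrite /F.
  by case: unpickle => [w|] //; case: ifP => // _; exact: measurable_cylinder.
rewrite /F; case: unpickle => [w|]; last by rewrite setI0 measure0.
by case: ifPn => [/asboolP Pw|_]; [exact: H|rewrite setI0 measure0].
Qed.

Lemma cylinders_sigma (A : set (set (plane R))) : sigma_algebra setT A ->
  (forall w, A (cyl w)) -> A cylinders.
Proof.
move=> [A0 _ AU] H; rewrite cylindersE; apply: AU => n; rewrite /F.
by case: unpickle => [w|] //; case: ifP.
Qed.

End words_union.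

(** In a cylinder of [P], reaching [C <= 6 A] and then reading two digits [true] produces a cylinder
    of [P'], which [Z] misses. Each trial costs [Z] a fixed proportion, and trials can be repeated
    because longer words stay narrow. *)
Lemma wide_null j : m (T `\` cylinders (@narrow R ((2 / 3) ^+ j))) = 0%E.
Proof.
have arith (Q a1 a2 a3 a4 a5 x y : R) : x <= Q * a2 -> y <= Q * a4 ->
    Q * (56^-1 * a5) <= Q * a1 -> a3 = a1 + a2 -> a5 = a3 + a4 ->
    x + y <= (1 - 56^-1) * Q * a5.
  by move=> h1 h2 h3 e1 e2; subst a5 a3; lra.
elim: j => [|j IH].
  rewrite (_ : _ `\` _ = set0) ?measure0// -subset0 => z [Tz]; apply.
  by exists [::]; [rewrite expr0; exact: narrow_nil|split].
set P := @narrow R ((2 / 3) ^+ j); set P' := @narrow R ((2 / 3) ^+ j.+1).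
pose Z := T `\` cylinders P'.
have mZ : measurable Z by apply: measurableD => //; exact: measurable_cylinders.
have ZP : m (Z `&` cylinders P) = 0%E.
  apply: cylinders_null => // w Pw; rewrite cmassE//; congr (_%:E).
  have Pcons b v : P v -> P (b :: v) by exact: narrow_cons.
  (* A loss of 1/56 at words with [C <= 6 A] becomes, by [reach_le], a loss of 1/224 at all words of
     [P]. *)
  pose q : R := 1 - 56^-1 / 4.
  have H n : forall v, P v -> cmass Z v <= q ^+ n * wmass v.
    elim: n => [|n IHn] v Pv; first by rewrite expr0 mul1r cmass_le.
    have q0 : 0 <= q ^+ n by rewrite exprn_ge0// /q; lra.
    rewrite exprS; apply: (@reach_le R P (cmass Z) (q ^+ n)) => //.
      by move=> u _; exact: cmass_split.
    move=> u Pu cu.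
    have Ptt : P' [:: true, true & u].
      by rewrite /P' exprSr; exact: narrow_contract.
    have tt0 : cmass Z [:: true, true & u] = 0.
      rewrite /cmass (_ : _ `&` _ = set0) ?measure0// -subset0 => z [[_ nP'] zu].
      by apply: nP'; exists [:: true, true & u].
    have h1 := IHn _ (Pcons false _ (Pcons true _ Pu)).
    have h2 := IHn _ (Pcons false _ Pu).
    have tt := wmass_true_true cu.
    rewrite (cmass_split u mZ) (cmass_split (true :: u) mZ) tt0 add0r.
    exact: arith h1 h2 (ler_wpM2l q0 tt) (wmass_split R (true :: u)) (wmass_split R u).
  have qlim : (fun n => q ^+ n * wmass w) @ \oo --> (0 * wmass w).
    apply: cvgM; last exact: cvg_cst.
    by apply: cvg_expr; rewrite ger0_norm /q; lra.
  apply/eqP; rewrite eq_le cmass_ge0 andbT.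
  rewrite mul0r in qlim; rewrite -(cvg_lim _ qlim)//; apply: limr_ge.
    by apply/cvg_ex; exists 0.
  by apply: nearW => n; exact: H.
apply: (@subset_measure0 _ _ _ m Z ((T `\` cylinders P) `|` (Z `&` cylinders P))) => //.
- apply: measurableU; [apply: measurableD|apply: measurableI] => //; exact: measurable_cylinders.
- move=> z Zz; have [|] := pselect (cylinders P z); [by right|left].
  by split => //; case: Zz.
- apply: null_set_setU => //; [apply: measurableD|apply: measurableI] => //; exact: measurable_cylinders.
Qed.

Lemma measurable_iter n (A : set (plane R)) : measurable A -> measurable (iter n S @^-1` A).
Proof.
move=> mA; elim: n => [//|n IH].
rewrite (_ : _ @^-1` _ = S @^-1` (iter n S @^-1` A)).
  exact: preimage_measurable.
by apply/seteqP; split => z /=; rewrite -iterSr.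
Qed.

(** Taken in the whole plane instead of the triangle, so that complements are again levels and the
    levels form an algebra. *)
Definition level n (P : pred (seq bool)) := [set z : plane R | P (digits n z)].

Lemma measurable_level n P : measurable (level n P).
Proof.
elim: n P => [|n IH] P.
  have [h|h] := boolP (P [::]).
    by rewrite (_ : level _ _ = setT)//; apply/seteqP; split.
  by rewrite (_ : level _ _ = set0)// -subset0 => z /=; rewrite /level/= (negbTE h).
have mG : measurable (iter n S @^-1` @Gamma0 R).
  by apply: measurable_iter; exact: measurable_Gamma0.
rewrite (_ : level _ _ =
    (iter n S @^-1` @Gamma0 R `&` level n (fun w => P (true :: w))) `|`
    (~` (iter n S @^-1` @Gamma0 R) `&` level n (fun w => P (false :: w)))).
  by apply: measurableU; apply: measurableI => //; exact: measurableC.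
apply/seteqP; split => z; rewrite /level /=.
  case: (boolP (iter n S z \in @Gamma0 R)) => G PG; [left|right]; split => //.
    exact: set_mem.
  by move=> /mem_set h; rewrite h in G.
by move=> [[/mem_set -> //]|[nG]]; rewrite memNset.
Qed.

Definition levels := [set A : set (plane R) | exists n P, A = level n P].

Lemma digits_drop n k (z : plane R) : (n <= k)%N -> digits n z = drop (k - n) (digits k z).
Proof.
elim: k => [|k IH]; first by rewrite leqn0 => /eqP ->.
rewrite leq_eqVlt => /predU1P[->|nk]; first by rewrite subnn drop0.
by rewrite subSn//= IH.
Qed.

Lemma level_widen n k P : (n <= k)%N ->
  level n P = level k (fun w => P (drop (k - n) w)).
Proof. by move=> nk; apply/seteqP; split => z; rewrite /level /= -digits_drop. Qed.

Lemma levels_measurable : levels `<=` measurable.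
Proof. by move=> _ [n [P ->]]; exact: measurable_level. Qed.

Lemma levels0 : levels set0.
Proof. by exists 0%N, pred0; rewrite /level; apply/seteqP; split. Qed.

Lemma levelsC : setC_closed levels.
Proof.
move=> _ [n [P ->]]; exists n, (fun w => ~~ P w).
by apply/seteqP; split => z; rewrite /level /= => /negP.
Qed.

Lemma levelsU : setU_closed levels.
Proof.
move=> _ _ [n [P ->]] [k [Q ->]]; exists (maxn n k).
rewrite (level_widen P (leq_maxl n k)) (level_widen Q (leq_maxr n k)).
exists (fun w => P (drop (maxn n k - n) w) || Q (drop (maxn n k - k) w)).
apply/seteqP; split => z; rewrite /level /=.
  by move=> [->|->]; rewrite ?orbT.
by move=> /orP[h|h]; [left|right].
Qed.

Local Notation approx := (approximable m levels).

Let approx_sigma : sigma_algebra setT approx.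
Proof.
exact: (approximable_sigma_algebra lebesgue_triangle_setT levels_measurable levels0 levelsC levelsU).
Qed.

Let approx_sub F F' : approx F -> measurable F' -> F `<=` F' ->
  m (F' `\` F) = 0%E -> approx F'.
Proof. exact: (approximable_sub levels_measurable). Qed.

Lemma approx_cylinder w : approx (cyl w).
Proof.
suff H : approx (level (size w) (pred1 w) `&` T).
  rewrite (_ : cyl w = level (size w) (pred1 w) `&` T)//.
  apply/seteqP; split => z; rewrite /cylinder /level /= => -[].
    by move=> Tz ->.
  by move=> /eqP.
have mL := measurable_level (size w) (pred1 w).
split; first exact: measurableI.
move=> e e0; exists (level (size w) (pred1 w)); first by exists (size w), (pred1 w).
rewrite [X in (X <= _)%E](_ : _ = 0%E) ?lee_fin ?ltW//.
rewrite /= /mrestr (_ : _ `&` _ = set0) ?measure0// -subset0 => z /=; tauto.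
Qed.

(** Almost every point of the half-plane lies in cylinders of arbitrarily small width, and one
    narrower than [c z - x] stays inside; up to a null set the half-plane is a countable union of
    cylinders. Both coordinates satisfy the Lipschitz condition. *)
Lemma approx_halfplane (c : plane R -> R) (x : R) :
  (forall z z' d, `|z.1 - z'.1| <= d -> `|z.2 - z'.2| <= d -> `|c z - c z'| <= d) ->
  measurable [set z | x < c z] -> approx [set z | x < c z].
Proof.
move=> cd mU; pose U := [set z | x < c z].
pose V := cylinders (fun w => cyl w `<=` U).
have mV : measurable V by exact: measurable_cylinders.
have aV : approx V by apply: cylinders_sigma => //; exact: approx_cylinder.
apply: (approx_sub aV) => //; first by move=> z [w wU /wU].
pose N := \bigcup_j (T `\` cylinders (@narrow R ((2 / 3) ^+ j))).
have mN j : measurable (T `\` cylinders (@narrow R ((2 / 3) ^+ j))).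
  by apply: measurableD => //; exact: measurable_cylinders.
have N0 : m N = 0%E by apply: bigcup_null => // j; exact: wide_null.
rewrite /= /mrestr -lebesgue_triangleE; last by move=> z [].
apply: (@subset_measure0 _ _ _ m _ N) => //.
- by apply: measurableI => //; exact: measurableD.
- exact: bigcup_measurable.
move=> z [[Uz nV] Tz]; apply: contrapT => nN; apply: nV.
have zlim : (fun n => (2 / 3 : R) ^+ n) @ \oo --> (0 : R).
  by apply: cvg_expr; rewrite ger0_norm; lra.
have [j jz] : exists j, (2 / 3 : R) ^+ j < c z - x.
  have cx : 0 < c z - x by rewrite subr_gt0.
  have /cvgrPdist_lt/(_ _ cx)[j _ /(_ j (leqnn j))] := zlim.
  rewrite sub0r normrN ger0_norm; first by move=> h; exists j.
  by rewrite exprn_ge0// divr_ge0.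
have [w nw zw] : cylinders (@narrow R ((2 / 3) ^+ j)) z.
  by apply: contrapT => h; apply: nN; exists j.
exists w => // z' zw' /=; have [d1 d2] := narrow_dist nw zw zw'.
change (x < c z'); have := cd _ _ _ d1 d2; rewrite ler_norml => /andP[_].
by lra.
Qed.

Lemma approx_measurable F : measurable F -> approx F.
Proof.
have half (c : plane R -> measurableTypeR R) :
    (forall z z' d, `|z.1 - z'.1| <= d -> `|z.2 - z'.2| <= d -> `|c z - c z'| <= d) ->
    (forall A, measurable A -> measurable (c @^-1` A)) ->
    forall A, measurable A -> approx (c @^-1` A).
  move=> cd mc A; rewrite (_ : measurable A <-> <<s @RGenOInfty.G R >> A); last first.
    by rewrite -[measurable]/((@ocitv R).-sigma.-measurable) RGenOInfty.measurableE.
  suff : <<s @RGenOInfty.G R >> `<=` [set A | approx (c @^-1` A)] by exact.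
  apply: smallest_sub.
    have [a0 aC aU] := approx_sigma; split.
    - by rewrite /= preimage_set0.
    - move=> B /= aB; rewrite setTD preimage_setC -setTD; exact: aC.
    - by move=> B aB /=; rewrite preimage_bigcup; exact: aU.
  move=> _ [x ->] /=.
  rewrite (_ : _ @^-1` _ = [set z | x < c z]); last first.
    by apply/seteqP; split => z /=; rewrite in_itv/= andbT.
  apply: approx_halfplane => //.
  rewrite (_ : [set z | _] = c @^-1` `]x, +oo[).
    by apply: mc; exact: measurable_itv.
  by apply/seteqP; split => z /=; rewrite in_itv/= andbT.
move: F; apply: smallest_sub => // B [[A mA <-]|[A mA <-]]; rewrite setTI.
- apply: half => // C mC; rewrite -[X in measurable X]setTI.
  exact: measurable_fst.
- apply: half => // C mC; rewrite -[X in measurable X]setTI.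
  exact: measurable_snd.
Qed.

(** * Invariant sets are null or conull *)

Section invariant_set.
Variable E : set (plane R).
Hypotheses (mE : measurable E) (ET : E `<=` T) (Einv : T `&` S @^-1` E = E).

Lemma invariant_set_cylinder w : E `&` cyl w = cyl w `&` iter (size w) S @^-1` E.
Proof.
have H n z : T z -> (E z <-> E (iter n S z)).
  move=> Tz; elim: n => // n IH; rewrite IH /= -[in X in X <-> _]Einv /=.
  split=> [[]//|h]; split => //; exact: (iter_set_fun (@triangle_map_fun R)).
apply/seteqP; split => z [].
  by move=> Ez wz; split => //=; have [h _] := H (size w) z (ET Ez); exact: h.
by move=> wz /= Ez; split => //; have [_ h] := H (size w) z (proj1 wz); exact: h.
Qed.

(** By invariance the part of [E] in the cylinder is the preimage of all of [E]. The form
    [lin (den w)] is at most its largest vertex value [C], and [C^2 <= 36 A B] gives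
    [1 / C^3 >= 1 / (36 A B C)], which is [wmass w / 18]. *)
Lemma invariant_cmass_distortion w : (den w).2 <= 6 * (den w).1.1 ->
  fine (m E) / 18 * wmass w <= cmass E w.
Proof.
move=> cu; have [/andP[a ab] bc] := den_ord R w.
have mEf : m E \is a fin_num.
  rewrite ge0_fin_numE//; apply: le_lt_trans lebesgue_triangle_setT.
  by apply: le_measure; rewrite ?inE.
rewrite -lee_fin -cmassE// invariant_set_cylinder [m (_ `&` _)]lebesgue_triangleE; last by move=> z [[]].
rewrite cylinder_preimage_measure//.
apply: (@le_trans _ _ (\int[L2]_(z in E) (((den w).2 ^- 3)%:E))%E).
  rewrite integral_cst// [X in (_ * X)%E](_ : _ = m E); last by rewrite lebesgue_triangleE.
  rewrite -(fineK mEf) -EFinM lee_fin.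
  have : 0 <= fine (m E) by exact: fine_ge0.
  rewrite /wmass; move: (fine (m E)) (den w) a ab bc cu => e [[p1 p2] p3] /= a ab bc cu e0.
  rewrite [leRHS]mulrC -mulrA ler_wpM2l// -invfM lef_pV2 ?posrE; last 2 first.
  - by rewrite !mulr_gt0//; lra.
  - by rewrite exprn_gt0//; lra.
  have : p3 * p3 <= (6 * p1) * (6 * p2) by apply: ler_pM; lra.
  have p30 : 0 <= p3 by lra.
  by move=> /(ler_wpM2l p30); rewrite !exprS expr0 mulr1; lra.
apply: ge0_le_integral => //.
- by move=> z _; rewrite lee_fin invr_ge0 exprn_ge0//; lra.
- exact: measurable_funTS (measurable_lin_cube _).
move=> z /ET Tz; have D0 : 0 < lin (den w) z by apply: lin_gt0 => //; lra.
rewrite lee_fin ger0_norm ?invr_ge0 ?exprn_ge0 ?(ltW D0)//.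
rewrite lef_pV2 ?posrE ?exprn_gt0//; last by lra.
rewrite lerXn2r ?nnegrE ?(ltW D0)//; first by lra.
move: Tz => [z1 [z21 z0]]; rewrite /lin.
have := ler_wpM2r (_ : 0 <= 1 - z.1) (le_trans ab bc); rewrite subr_ge0 => /(_ z1).
have := ler_wpM2r (_ : 0 <= z.1 - z.2) bc; rewrite subr_ge0 => /(_ z21).
by lra.
Qed.

(** [reach_le] propagates upper bounds, so it is applied to the complement of [E] with
    [eta = m E / 18]; 72 is 18 times the 4 of [reach_le]. *)
Lemma invariant_cmass w : fine (m E) / 72 * wmass w <= cmass E w.
Proof.
have mTE : measurable (T `\` E) by exact: measurableD.
have sumE v : cmass E v + cmass (T `\` E) v = wmass v.
  apply: EFin_inj; rewrite EFinD -!cmassE// -lebesgue_triangle_cylinder.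
  rewrite -measureU.
  - rewrite -setIUl (_ : E `|` _ = T); last first.
      by apply/seteqP; split => z /=; have := @ET z; have := EM (E z); tauto.
    by rewrite setIidr// => z [].
  - by apply: measurableI => //; exact: measurable_cylinder.
  - by apply: measurableI => //; exact: measurable_cylinder.
  - by rewrite setIACA setDIK set0I.
have := @reach_le R (fun=> True) (cmass (T `\` E)) 1 _ ler01 _ _ (fine (m E) / 18) _ _ w I.
rewrite !mulr1 => H.
suff : cmass (T `\` E) w <= (1 - fine (m E) / 18 / 4) * wmass w.
  by clear H; have := sumE w; lra.
apply: H => //.
- by move=> v _; exact: cmass_split.
- by move=> v _; rewrite mul1r; exact: cmass_le.
- move=> v _ cu; have := invariant_cmass_distortion cu; have := sumE v.
  by lra.
Qed.

Lemma invariant_level n P :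
  ((fine (m E) / 72)%:E * m (level n P) <= m (E `&` level n P))%E.
Proof.
set kappa := fine (m E) / 72; have kappa0 : 0 <= kappa by rewrite divr_ge0// fine_ge0.
have mL := measurable_level n P.
have mC := @measurable_cylinder R.
(* Induction on the number [k] of digits still to be read: the cylinder is split until its word has
   length [n], when it lies inside the level or misses it. *)
suff H k w : (size w + k)%N = n ->
    (kappa%:E * m (level n P `&` cyl w) <= m (E `&` level n P `&` cyl w))%E.
  have := H n [::] (add0n _).
  have c0 : cyl [::] = T by apply/seteqP; split => z // [].
  by rewrite c0 !lebesgue_triangleI.
elim: k w => [|k IH] w; last first.
  rewrite addnS -addSn => sw.
  rewrite (measure_cylinder_split w mL) (measure_cylinder_split w (measurableI _ _ mE mL)).
  by rewrite ge0_muleDr// leeD// IH.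
rewrite addn0 => sw.
have [Pw|nPw] := boolP (P w); last first.
  rewrite (_ : level n P `&` _ = set0) ?measure0 ?mule0// -subset0 => z [Lz [_ wz]].
  by move/negP: nPw; apply; rewrite -wz sw.
have cL : cyl w `<=` level n P by move=> z [_ wz]; rewrite /level/= -sw wz.
rewrite -setIA (setIidr cL) lebesgue_triangle_cylinder cmassE// -EFinM lee_fin.
exact: invariant_cmass.
Qed.

(** The complement [F] is within [e] of some level [L]. Then [E] meets [L] in measure at most [e],
    but at least [kappa * m L] by [invariant_level]; hence [kappa * m F <= (1 + kappa) * e] for
    every [e]. *)
Lemma invariant_null_or_full : m E = 0%E \/ m (T `\` E) = 0%E.
Proof.
have [->|E0] := eqVneq (m E) 0%E; [by left|right].
set kappa := fine (m E) / 72.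
have mEoo : (m E < +oo)%E.
  apply: le_lt_trans lebesgue_triangle_setT.
  by apply: le_measure; rewrite ?inE.
have kappa0 : 0 < kappa.
  by rewrite divr_gt0// fine_gt0// mEoo lt_neqAle eq_sym E0 measure_ge0.
pose F := T `\` E; have mF : measurable F by exact: measurableD.
have mFf : m F \is a fin_num.
  rewrite ge0_fin_numE//; apply: le_lt_trans lebesgue_triangle_setT.
  by apply: le_measure; rewrite ?inE.
have H e : 0 < e -> kappa * fine (m F) <= (1 + kappa) * e.
  move=> e0; have [_ /(_ _ e0)[_ [n [P ->]] h]] := approx_measurable mF.
  have mL := measurable_level n P.
  have h1 : (m (F `\` level n P) <= e%:E)%E.
    apply: le_trans h; apply: le_measure; rewrite ?inE; [exact: measurableD| |].
      by apply: measurableU; exact: measurableD.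
    by move=> z; left.
  have h2 : (m (E `&` level n P) <= e%:E)%E.
    apply: le_trans h; apply: le_measure; rewrite ?inE; [exact: measurableI| |].
      by apply: measurableU; exact: measurableD.
    by move=> z [Ez Lz]; right; split => // -[].
  have h3 := le_trans (invariant_level n P) h2.
  have h4 : (m F <= m (level n P) + e%:E)%E.
    rewrite (measureDI m mF mL) addeC; apply: leeD => //.
    by apply: le_measure; rewrite ?inE; [exact: measurableI|exact: mL|move=> z []].
  have := lee_wpmul2l (_ : (0 <= kappa%:E)%E) h4.
  rewrite lee_fin (ltW kappa0) => /(_ isT).
  have e0' : (0 <= e%:E)%E by rewrite lee_fin ltW.
  rewrite (ge0_muleDr _ (measure_ge0 m (level n P)) e0') => h5.
  have := le_trans h5 (leeD2r _ h3).
  by rewrite -(fineK mFf) -!EFinM -EFinD lee_fin; lra.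
have f0 : 0 <= fine (m F) by exact: fine_ge0.
rewrite -(fineK mFf); congr (_%:E); apply/eqP; rewrite eq_le f0 andbT leNgt.
apply/negP => fp; have kf : 0 < kappa * fine (m F) by rewrite mulr_gt0.
have k1 : 0 < 1 + kappa by lra.
have := H (kappa * fine (m F) / (2 * (1 + kappa))).
rewrite divr_gt0// ?mulr_gt0// => /(_ isT).
rewrite (_ : (1 + kappa) * _ = kappa * fine (m F) / 2); last first.
  by field; rewrite gt_eqF.
by lra.
Qed.

End invariant_set.

Lemma triangle_mu_ergodic : ergodic T S (@triangle_mu R).
Proof.
move=> A mA AT Ainv; have mTA : measurable (T `\` A) by exact: measurableD.
have TAT : T `\` A `<=` T by move=> z [].
have [|] := invariant_null_or_full mA AT Ainv; rewrite lebesgue_triangleE// => h.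
  by left; apply/triangle_mu_eq0.
by right; apply/triangle_mu_eq0.
Qed.

End ergodicity.

Theorem proposition2p1 (R : realType) :
  [/\ conservative (@triangle R) (@triangle_map R) (@triangle_mu R),
      [/\ @triangle_mu R `<< lebesgue_triangle R,
          invariant_measure (@triangle R) (@triangle_map R) (@triangle_mu R)
        & ergodic (@triangle R) (@triangle_map R) (@triangle_mu R)],
      (forall nu : {measure set (plane R) -> \bar R},
        sigma_finite (@triangle R) nu ->
        nu `<< lebesgue_triangle R ->
        invariant_measure (@triangle R) (@triangle_map R) nu ->
        ergodic (@triangle R) (@triangle_map R) nu ->
        nu (@triangle R) != 0%E ->
        exists2 c : R, 0 < c &
          forall A, measurable A -> nu A = (c%:E * triangle_mu A)%E),
      sigma_finite (@triangle R) (@triangle_mu R)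
    & @triangle_mu R (@triangle R) = +oo%E].
Proof.
have mT := @measurable_triangle R; have mS := @measurable_triangle_map R.
have ST := @triangle_map_fun R; have inv := @triangle_mu_invariant R.
have mG := @measurable_Gamma0 R; have GT := @Gamma0_sub_triangle R.
have G0 := triangle_mu_Gamma0_lty R; have sw := Gamma0_sweep R.
have muI A : measurable A -> triangle_mu (A `&` @triangle R) = triangle_mu A.
  by move=> mA; rewrite /triangle_mu -setIA setIid.
split.
- exact: (sweep_conservative mT mS ST inv mG GT G0 sw).
- split => //; last exact: triangle_mu_ergodic.
  apply/null_content_dominatesP => A mA A0; rewrite -muI//.
  apply/triangle_mu_eq0; [exact: measurableI|by move=> z []|exact: A0].
- move=> nu nuT numu nu_inv _ nuT0; move/null_content_dominatesP : numu => numu.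
  have nu_null B : measurable B -> B `<=` @triangle R -> triangle_mu B = 0%E -> nu B = 0%E.
    move=> mB BT B0; apply: (numu _ mB); apply: etrans (lebesgue_triangleE BT) _.
    exact/triangle_mu_eq0.
  have [c c0 H] := invariant_measure_unique mT mS ST inv (@triangle_mu_ergodic R) mG GT G0 sw
    (triangle_mu_sigma_finite R) nuT nu_inv nu_null nuT0.
  exists c => // A mA; rewrite -muI// -H; [|exact: measurableI|by move=> z []].
  (* [nu] vanishes outside the triangle because [lebesgue_triangle] does. *)
  rewrite (measureDI nu mA mT) [X in (X + _)%E]numu ?add0e//; first exact: measurableD.
  by rewrite /= /mrestr setDKI measure0.
- exact: triangle_mu_sigma_finite.
- exact: triangle_mu_triangle.
Qed.
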